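(* Let $E$ be a $\sigma$-MV-effect algebra, let $\mathcal{SBO}(E)$ be the set of sharp bounded observables on $E$ with the sum $+$ of observables and the Olson order $\preceq_s$, and let $o:=q_0$. (1) If $a$ and $b$ are two sharp elements of $E$ such that $a+b$ exists in $E$, then $q_a+q_b=q_{a+b}$. (2) Let $x$ be a sharp observable on $E$ such that $o\preceq_s x\preceq_s q_1$. If we set $x'=f\circ x$, where $f(t)=1-t$, $t\in\mathbb R$, then $o\preceq_s x'\preceq_s q_1$. In addition, $x\vee x'=q_1$ (join in the Olson order) if and only if $x=q_a$ for some sharp element $a\in E$. In such a case, $a$ is unique. (3) If $M=\Gamma(\mathcal{SBO}(E),q_1)$, then $M$ is a $\sigma$-MV-effect algebra such that $\mathrm{Sh}(M)$ is $\sigma$-isomorphic to $\mathrm{Sh}(E)$. (4) $\mathcal{SBO}(E)$ is a Dedekind $\sigma$-complete $\ell$-group.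
   Context: An effect algebra is a partial algebra $(E;+,0,1)$ with a partial binary operation $+$ such that for all $a,b,c\in E$: (i) $a+b$ is defined iff $b+a$ is, and then $a+b=b+a$; (ii) $a+b$ and $(a+b)+c$ are defined iff $b+c$ and $a+(b+c)$ are, and then $(a+b)+c=a+(b+c)$; (iii) for each $a$ there is a unique $a'\in E$ with $a+a'=1$; (iv) if $a+1$ is defined then $a=0$. It is partially ordered by $a\le b$ iff $a+c=b$ for some $c\in E$. An MV-effect algebra is an effect algebra that is a lattice under $\le$ and in which $a\wedge b=0$ implies that $a+b$ is defined. A $\sigma$-MV-effect algebra is an MV-effect algebra in which all countable joins and meets exist. An element $a\in E$ is sharp if $a\wedge a'$ exists and equals $0$; $\mathrm{Sh}(E)$ is the set of sharp elements. For $E$ a $\sigma$-MV-effect algebra, $\mathrm{Sh}(E)$ is a sub-effect algebra of $E$ that is a Boolean $\sigma$-algebra. A $\sigma$-isomorphism of such (Boolean $\sigma$-)effect algebras is an isomorphism of effect algebras (a bijection $\phi$ preserving $0$ and $1$ such that $a+b$ exists iff $\phi(a)+\phi(b)$ exists, and then $\phi(a+b)=\phi(a)+\phi(b)$) that preserves countable joins. An observable on $E$ is a mapping $x:\mathcal B(\mathbb R)\to E$ ($\mathcal B(\mathbb R)$ the Borel $\sigma$-algebra of $\mathbb R$) such that (i) $x(\mathbb R)=1$; (ii) if $A\cap B=\emptyset$ then $x(A)+x(B)$ is defined and $x(A\cup B)=x(A)+x(B)$; (iii) if $A_i\subseteq A_{i+1}$ for each $i$ and $\bigcup_iA_i=A$,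 then $x(A)=\bigvee_ix(A_i)$. It is bounded if $x([\alpha,\beta])=1$ for some interval $[\alpha,\beta]$, and sharp if $x(A)\in\mathrm{Sh}(E)$ for each $A\in\mathcal B(\mathbb R)$. Put $B_x(t):=x((-\infty,t))$, $t\in\mathbb R$; the system $\{B_x(t):t\in\mathbb R\}$ is the spectral resolution of $x$ and determines $x$ uniquely. For a Borel function $f:\mathbb R\to\mathbb R$, $f\circ x$ is the observable $A\mapsto x(f^{-1}(A))$. Sum of bounded observables $x,y$ on $E$: $x+y$ is the unique bounded observable on $E$ whose spectral resolution is $B_{x+y}(t)=\bigvee_{r\in\mathbb Q}(B_x(r)\wedge B_y(t-r))$, $t\in\mathbb R$. Olson order: $x\preceq_s y$ iff $B_y(t)\le B_x(t)$ for each $t\in\mathbb R$. Joins of bounded observables are taken in the lattice of bounded observables on $E$ under $\preceq_s$. For $a\in E$, the question $q_a$ is the observable with $q_a(A)=1$ if $0,1\in A$; $q_a(A)=a$ if $1\in A$, $0\notin A$; $q_a(A)=a'$ if $0\in A$, $1\notin A$; $q_a(A)=0$ if $0,1\notin A$. An $\ell$-group here is an Abelian group with a lattice order that is invariant under translation. $\mathcal{SBO}(E)$ with $+$ and $\preceq_s$ is an $\ell$-group with strong unit $q_1$ and zero element $o$. For an Abelian partially ordered group $G$ and $u\ge 0$ in $G$, $\Gamma(G,u):=\{g\in G:0\le g\le u\}$ is the effect algebra $(\Gamma(G,u);+,0,u)$ where $g+h$ is the group sum and is defined iff it lies in $\Gamma(G,u)$. An $\ell$-group is Dedekind $\sigma$-complete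 if every nonempty countable subset that is bounded above has a supremum. *)

(* Defs.v *)
From HB Require Import structures.
From mathcomp Require Import all_boot all_order all_algebra.
From mathcomp Require Import all_classical all_reals all_analysis.
From mathcomp Require Import measurable_realfun.

Set Implicit Arguments.
Unset Strict Implicit.
Unset Printing Implicit Defensive.

Import Order.TTheory GRing.Theory Num.Theory.
Import numFieldNormedType.Exports.
Local Open Scope classical_set_scope.
Local Open Scope ring_scope.

(* Suprema and infima of a set S for a relation le; no structure is assumed on
   T because the orders considered here are derived from partial sums. *)
Definition is_lub (T : Type) (le : T -> T -> Prop) (S : set T) (s : T) : Prop :=
  (forall a, S a -> le a s) /\ (forall b, (forall a, S a -> le a b) -> le s b).

Definition is_glb (T : Type) (le : T -> T -> Prop) (S : set T) (s : T) : Prop :=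
  (forall a, S a -> le s a) /\ (forall b, (forall a, S a -> le b a) -> le b s).

(* Partial operations are given by their graphs: psum a b c means that a + b is
   defined and equal to c. *)
Record partialAlgebra : Type := PartialAlgebra {
  pcarrier :> Type;
  psum : pcarrier -> pcarrier -> pcarrier -> Prop;
  pzero : pcarrier;
  pone : pcarrier
}.

Arguments pzero {p}.
Arguments pone {p}.

Definition summable (P : partialAlgebra) (a b : P) : Prop :=
  exists c, psum a b c.

Record is_effect_algebra (P : partialAlgebra) : Prop := IsEffectAlgebra {
  psum_functional : forall a b c d : P, psum a b c -> psum a b d -> c = d;
  psumC : forall a b c : P, psum a b c -> psum b a c;
  psumA : forall a b c d : P,
    (exists s, psum a b s /\ psum s c d) <->
    (exists s, psum b c s /\ psum a s d);
  orthosupplement : forall a : P, exists! a', psum a a' pone;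
  summable1 : forall a : P, summable a pone -> a = pzero
}.

Record effectAlgebra : Type := EffectAlgebra {
  ea_sort :> partialAlgebra;
  ea_axioms : is_effect_algebra ea_sort
}.

Definition ple (P : partialAlgebra) (a b : P) : Prop := exists c, psum a c b.

Definition oc (E : effectAlgebra) (a : E) : E :=
  sval (cid (orthosupplement (ea_axioms E) a)).

Definition is_MV_effect_algebra (E : effectAlgebra) : Prop :=
  (forall a b : E, (exists s, is_lub (@ple E) [set a; b] s) /\
                   (exists m, is_glb (@ple E) [set a; b] m)) /\
  (forall a b : E, is_glb (@ple E) [set a; b] pzero -> summable a b).

Definition is_sigma_MV_effect_algebra (E : effectAlgebra) : Prop :=
  is_MV_effect_algebra E /\
  (forall S : set E, countable S ->
     (exists s, is_lub (@ple E) S s) /\ (exists m, is_glb (@ple E) S m)).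

Definition sharp (E : effectAlgebra) (a : E) : Prop :=
  is_glb (@ple E) [set a; oc a] pzero.

Definition is_sigma_isomorphism (P Q : partialAlgebra) (phi : P -> Q) : Prop :=
  bijective phi /\
  phi pzero = pzero /\ phi pone = pone /\
  (forall a b : P, summable a b <-> summable (phi a) (phi b)) /\
  (forall a b c : P, psum a b c -> psum (phi a) (phi b) (phi c)) /\
  (forall (S : set P) (s : P), countable S ->
     is_lub (@ple P) S s -> is_lub (@ple Q) (phi @` S) (phi s)).

Definition sigma_isomorphic (P Q : partialAlgebra) : Prop :=
  exists phi : P -> Q, is_sigma_isomorphism phi.

Section EffectAlgebraTheory.
Variable E : effectAlgebra.
Implicit Types a b : E.

Lemma psum_oc a : psum a (oc a) pone.
Proof. by rewrite /oc; case: cid => b []. Qed.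

Lemma oc_unique a b : psum a b pone -> b = oc a.
Proof.
rewrite /oc; case: cid => c [_ cU] /= /cU ->; by [].
Qed.

Lemma psum_sym a b c : @psum E a b c -> psum b a c.
Proof. exact: psumC (ea_axioms E) _ _ _. Qed.

Lemma psum10 : @psum E pone pzero pone.
Proof.
have h := psum_oc pone.
have h0 : oc (pone : E) = pzero.
  by apply: (summable1 (ea_axioms E)); exists pone; exact: psum_sym.
by rewrite -h0.
Qed.

Lemma psuma0 a : psum a pzero a.
Proof.
have /(psumA (ea_axioms E)) [u [au u1]] :
    exists s, psum (oc a) a s /\ psum s pzero pone.
  by exists pone; split; [exact/psum_sym/psum_oc | exact: psum10].
have -> : a = oc (oc a) by apply: oc_unique; exact/psum_sym/psum_oc.
by rewrite -{2}(oc_unique u1) (_ : oc (oc a) = a) //; apply/esym/oc_unique;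
   exact/psum_sym/psum_oc.
Qed.

Lemma psum0a a : psum pzero a a.
Proof. exact/psum_sym/psuma0. Qed.

Lemma ple_refl a : ple a a.
Proof. by exists pzero; exact: psuma0. Qed.

Lemma ple0 a : ple pzero a.
Proof. by exists a; exact: psum0a. Qed.

Lemma ple1 a : ple a pone.
Proof. by exists (oc a); exact: psum_oc. Qed.

Lemma ocK a : oc (oc a) = a.
Proof. by apply/esym/oc_unique/psum_sym/psum_oc. Qed.

Lemma sharp_oc a : sharp a -> sharp (oc a).
Proof. by rewrite /sharp ocK setUC. Qed.

Lemma sharp0 : sharp (pzero : E).
Proof.
split=> [a _|b hb]; first exact: ple0.
by apply: hb; left.
Qed.

Lemma sharp1 : sharp (pone : E).
Proof.
split=> [a _|b hb]; first exact: ple0.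
by apply: hb; right; apply: oc_unique; exact: psum10.
Qed.

(* Sh(E) with the operation inherited from E. *)
Definition Sh : partialAlgebra :=
  @PartialAlgebra {a : E | sharp a}
    (fun u v w => @psum E (sval u) (sval v) (sval w))
    (exist _ _ sharp0) (exist _ _ sharp1).

End EffectAlgebraTheory.

Section Observables.
Variable R : realType.

Definition borel : Type := {A : set R | measurable A}.

Definition borel_itv (i : interval R) : borel := exist _ [set` i] (measurable_itv i).

Record is_observable (P : partialAlgebra) (x : borel -> P) : Prop := IsObservable {
  obsT : forall A : borel, sval A = setT -> x A = pone;
  obsU : forall A B C : borel, sval A `&` sval B = set0 ->
    sval C = sval A `|` sval B -> psum (x A) (x B) (x C);
  obs_lub : forall (A_ : nat -> borel) (A : borel),
    (forall i, sval (A_ i) `<=` sval (A_ i.+1)) ->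
    \bigcup_i sval (A_ i) = sval A ->
    is_lub (@ple P) (range (fun i => x (A_ i))) (x A)
}.

Record observable (P : partialAlgebra) : Type := Observable {
  obs_fun :> borel -> P;
  obs_axioms : is_observable obs_fun
}.

Definition bounded_obs (P : partialAlgebra) (x : observable P) : Prop :=
  exists alpha beta : R, x (borel_itv `[alpha, beta]) = pone.

Definition sharp_obs (E : effectAlgebra) (x : observable E) : Prop :=
  forall A, sharp (x A).

(* Spectral resolution B_x. *)
Definition spec (P : partialAlgebra) (x : observable P) (t : R) : P :=
  x (borel_itv `]-oo, t[).

Definition olson (P : partialAlgebra) (x y : observable P) : Prop :=
  forall t, ple (spec y t) (spec x t).

(* z is a join of x and y in the poset of bounded observables. *)
Definition bounded_join (P : partialAlgebra) (x y z : observable P) : Prop :=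
  bounded_obs z /\ olson x z /\ olson y z /\
  (forall w, bounded_obs w -> olson x w -> olson y w -> olson z w).

(* z = x + y. *)
Definition obs_sum (P : partialAlgebra) (x y z : observable P) : Prop :=
  unique (fun w : observable P => bounded_obs w /\
    forall t : R, is_lub (@ple P)
      [set m | exists r : rat,
         is_glb (@ple P) [set spec x (ratr r); spec y (t - ratr r)] m]
      (spec w t)) z.

Definition borel_preimage (f : R -> R) (mf : measurable_fun setT f) (A : borel) :
    borel :=
  exist _ (setT `&` f @^-1` sval A) (mf measurableT (sval A) (svalP A)).

Lemma obs_comp_subproof (P : partialAlgebra) (f : R -> R)
    (mf : measurable_fun setT f) (x : observable P) :
  is_observable (fun A => x (borel_preimage mf A)).
Proof.
split.
- move=> A AT; apply: (obsT (obs_axioms x)).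
  by rewrite /= AT preimage_setT setIT.
- move=> A B C AB0 CAB; apply: (obsU (obs_axioms x)) => /=; rewrite !setTI.
    by rewrite -preimage_setI AB0 preimage_set0.
  by rewrite CAB preimage_setU.
- move=> A_ A Ai AU.
  apply: (obs_lub (obs_axioms x) (A_ := fun i => borel_preimage mf (A_ i))).
    by move=> i t /= [_ h]; split => //; exact: Ai.
  rewrite /= setTI -AU preimage_bigcup.
  by apply: eq_bigcupr => i _ /=; rewrite setTI.
Qed.

Definition obs_comp (P : partialAlgebra) (f : R -> R)
    (mf : measurable_fun setT f) (x : observable P) : observable P :=
  Observable (obs_comp_subproof mf x).

Lemma measurable_one_minus : measurable_fun setT (fun t : R => 1 - t).
Proof.
by apply: measurable_funB; [exact: measurable_cst | exact: measurable_id].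
Qed.

Definition question_fun (E : effectAlgebra) (a : E) (A : borel) : E :=
  if 1 \in sval A then (if 0 \in sval A then pone else a)
  else (if 0 \in sval A then oc a else pzero).

Lemma question_subproof (E : effectAlgebra) (a : E) :
  is_observable (question_fun a).
Proof.
rewrite /question_fun; split.
- by move=> A ->; rewrite !in_setT.
- move=> A B C AB0 ->; rewrite !in_setU.
  have no t : t \in sval A -> t \in sval B -> False.
    rewrite !inE => At Bt; have : (sval A `&` sval B) t by [].
    by rewrite AB0.
  have := no 0; have := no 1.
  case: (1 \in sval A); case: (1 \in sval B) => //=.
  + by move=> /(_ isT isT).
  + move=> _; case: (0 \in sval A); case: (0 \in sval B) => //= h.
    * by case: (h isT isT).
    * exact: psuma0.
    * exact: psum_oc.
    * exact: psuma0.
  + move=> _; case: (0 \in sval A); case: (0 \in sval B) => //= h.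
    * by case: (h isT isT).
    * exact/psum_sym/psum_oc.
    * exact: psum0a.
    * exact: psum0a.
  + move=> _; case: (0 \in sval A); case: (0 \in sval B) => //= h.
    * by case: (h isT isT).
    * exact: psuma0.
    * exact: psum0a.
    * exact: psuma0.
- move=> A_ A Ai AU.
  have mono i j : (i <= j)%N -> sval (A_ i) `<=` sval (A_ j).
    elim: j => [|j IH]; first by rewrite leqn0 => /eqP ->.
    rewrite leq_eqVlt => /orP[/eqP -> //|]; rewrite ltnS => /IH h t /h.
    exact: Ai.
  have stab t : exists N, forall i, (N <= i)%N ->
      (t \in sval (A_ i)) = (t \in sval A).
    have [tA|tA] := boolP (t \in sval A).
      move: tA; rewrite inE -AU => -[N _ ht]; exists N => i Ni.
      by apply/mem_set; exact: mono ht.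
    exists 0%N => i _; apply/negbTE; apply: contra tA; rewrite !inE -AU => h.
    by exists i.
  have sub t i : t \in sval (A_ i) -> t \in sval A.
    by rewrite !inE -AU => h; exists i.
  split.
    move=> _ [i _ <-]; have := sub 1 i; have := sub 0 i.
    case: (1 \in sval (A_ i)); case: (0 \in sval (A_ i)) => /= h0 h1.
    + by rewrite h0// h1//; exact: ple_refl.
    + by rewrite h1//; case: ifP => _; [exact: ple1 | exact: ple_refl].
    + by rewrite h0//; case: ifP => _; [exact: ple1 | exact: ple_refl].
    + exact: ple0.
  move=> b hb; have [N0 h0] := stab 0; have [N1 h1] := stab 1.
  rewrite -(h0 (maxn N0 N1)) ?leq_maxl// -(h1 (maxn N0 N1)) ?leq_maxr//.
  by apply: hb; exists (maxn N0 N1).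
Qed.

Definition question (E : effectAlgebra) (a : E) : observable E :=
  Observable (question_subproof a).

Lemma question_bounded (E : effectAlgebra) (a : E) : bounded_obs (question a).
Proof.
exists 0, 1 => /=; rewrite /question_fun /= !mem_setE.
by rewrite !in_itv /= !lexx ler01.
Qed.

Lemma question_sharp (E : effectAlgebra) (a : E) :
  sharp a -> sharp_obs (question a).
Proof.
move=> sa A; rewrite /= /question_fun.
by case: ifP => _; case: ifP => _ //; [exact: sharp1 | exact: sharp_oc |
  exact: sharp0].
Qed.

Lemma olson_refl (E : effectAlgebra) (x : observable E) : olson x x.
Proof. by move=> t; exact: ple_refl. Qed.

Lemma olson_question01 (E : effectAlgebra) :
  olson (question (pzero : E)) (question (pone : E)).
Proof.
move=> t; rewrite /spec /= /question_fun /= !mem_setE !in_itv /=.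
have oc1 : oc (pone : E) = pzero by apply/esym/oc_unique/psum10.
have [t1|_] := boolP (1 < t); last by rewrite oc1; case: ifP => _; exact: ple0.
by rewrite (lt_trans ltr01 t1); exact: ple_refl.
Qed.

End Observables.

(* Underlying data of a partially ordered group; gsum g h k means g + h = k.
   That every sum exists and is unique is an axiom of is_abelian_group. *)
Record groupData : Type := GroupData {
  gcarrier :> Type;
  gsum : gcarrier -> gcarrier -> gcarrier -> Prop;
  gzero : gcarrier;
  gle : gcarrier -> gcarrier -> Prop
}.

Arguments gzero {g}.

Record is_abelian_group (G : groupData) : Prop := IsAbelianGroup {
  gsum_total : forall g h : G, exists! k, gsum g h k;
  gsumC : forall g h k : G, gsum g h k -> gsum h g k;
  gsumA : forall g h k s t u : G,
    gsum g h s -> gsum s k t -> gsum h k u -> gsum g u t;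
  gsum0 : forall g : G, gsum gzero g g;
  gsumN : forall g : G, exists h, gsum g h gzero
}.

Record is_lgroup (G : groupData) : Prop := IsLGroup {
  lgroup_group : is_abelian_group G;
  gle_refl : forall g : G, gle g g;
  gle_anti : forall g h : G, gle g h -> gle h g -> g = h;
  gle_trans : forall g h k : G, gle g h -> gle h k -> gle g k;
  gle_translation : forall g h k s t : G,
    gle g h -> gsum g k s -> gsum h k t -> gle s t;
  gle_lub : forall g h : G, exists s, is_lub (@gle G) [set g; h] s;
  gle_glb : forall g h : G, exists m, is_glb (@gle G) [set g; h] m
}.

Definition is_dedekind_sigma_complete (G : groupData) : Prop :=
  forall S : set G, countable S -> S !=set0 ->
    (exists b, forall g, S g -> gle g b) -> exists s, is_lub (@gle G) S s.

(* Gamma(G, u); reflexivity of the order puts 0 and u in the carrier. *)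
Definition Gamma (G : groupData) (u : G) (le_refl : forall g : G, gle g g)
    (u_ge0 : gle gzero u) : partialAlgebra :=
  @PartialAlgebra {g : G | gle gzero g /\ gle g u}
    (fun g h k => gsum (sval g) (sval h) (sval k))
    (exist _ gzero (conj (le_refl gzero) u_ge0))
    (exist _ u (conj u_ge0 (le_refl u))).

Section SBO.
Variables (R : realType) (E : effectAlgebra).

Definition sbo : Type := {x : observable R E | bounded_obs x /\ sharp_obs x}.

Definition sbo_question (a : E) (sa : sharp a) : sbo :=
  exist _ (question R a) (conj (question_bounded R a) (question_sharp sa)).

Definition SBO : groupData :=
  @GroupData sbo
    (fun x y z => obs_sum (sval x) (sval y) (sval z))
    (sbo_question (sharp0 E))
    (fun x y => olson (sval x) (sval y)).

Definition Gamma_SBO : partialAlgebra :=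
  @Gamma SBO (sbo_question (sharp1 E)) (fun x => olson_refl (sval x))
    (@olson_question01 R E).

End SBO.

(* Main.v *)
Require Import Defs.
From HB Require Import structures.
From mathcomp Require Import all_boot all_order all_algebra.
From mathcomp Require Import all_classical all_reals all_analysis.
From mathcomp Require Import measurable_realfun.

Set Implicit Arguments.
Unset Strict Implicit.
Unset Printing Implicit Defensive.

Import Order.TTheory GRing.Theory Num.Theory.
Import numFieldNormedType.Exports.
Local Open Scope classical_set_scope.
Local Open Scope ring_scope.

(** The theorem is true because sharp bounded observables are functions.

    In a sigma-MV-effect algebra two disjoint elements are summable, so a sharp
    element is one that bounds every sum of elements below it
    ([sharp_principal]); hence infima and suprema of sharp elements are sharp,
    and the sharp elements form a Boolean sigma-algebra. Its ultrafilters are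
    the points of a Stone space. A countable join of sharp elements corresponds
    to the union of the corresponding sets of ultrafilters only up to a nowhere
    dense set ([ae_lub]), but meagre sets can be neglected: by the Baire argument
    [ae_witness] no nonzero sharp element lives on a meagre set. So, modulo
    meagre sets, the sharp elements are a sigma-algebra of sets on the Stone
    space ([sigma_algebra_representable], the Loomis-Sikorski theorem).

    Consequently a measurable real function [f] on the Stone space defines the
    sharp observable sending a Borel set [A] to the element represented by the
    event that [f] lies in [A] ([observable_of_fun]), and every sharp bounded
    observable arises so, from the function that reads off at which level its
    spectral resolution enters an ultrafilter ([fun_of_observable]). Under this
    correspondence the Olson order is the order almost everywhere ([olsonP]), the
    sum of observables is the sum of functions ([Rep_obs_sum]), and the question
    of [a] is the indicator function of [a] ([Rep_question], [Rep_zero_one]).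

    What remains are facts about bounded measurable functions modulo equality
    almost everywhere: indicators of disjoint events add up; the maximum of [f]
    and [1 - f] is [1] exactly where [f] is [0] or [1]; the functions form a
    lattice-ordered group in which countable bounded families have pointwise
    suprema; in its unit interval the sharp elements, those with
    [min f (1 - f) = 0], are the indicator functions. *)

(** * Effect algebras *)

Section EffectAlgebraBasics.
Variable E : effectAlgebra.
Implicit Types a b c d s t z : E.

Lemma psum_fun a b c d : @psum E a b c -> psum a b d -> c = d.
Proof. exact: psum_functional (ea_axioms E) _ _ _ _. Qed.

Lemma psum_assoc a b c s d : @psum E a b s -> psum s c d ->
  exists2 t, psum b c t & psum a t d.
Proof.
move=> abs scd.
have /(psumA (ea_axioms E)) [t [bct atd]] :
  exists s, @psum E a b s /\ psum s c d by exists s.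
by exists t.
Qed.

Lemma psum_assocr a b c t d : @psum E b c t -> psum a t d ->
  exists2 s, psum a b s & psum s c d.
Proof.
move=> bct atd.
have /(psumA (ea_axioms E)) [s [abs scd]] :
  exists t, @psum E b c t /\ psum a t d by exists t.
by exists s.
Qed.

Lemma psum_cancel a b b' c : @psum E a b c -> psum a b' c -> b = b'.
Proof.
move=> /psum_sym bac /psum_sym b'ac.
have [t act bt1] := psum_assoc bac (psum_oc c).
have [t' act' b't1] := psum_assoc b'ac (psum_oc c).
rewrite (psum_fun act' act) in b't1.
by rewrite (oc_unique (psum_sym bt1)) (oc_unique (psum_sym b't1)).
Qed.

Lemma psum_eq0 a b : @psum E a b pzero -> a = pzero.
Proof.
move=> /psum_sym ba0.
have [t a1 _] := psum_assoc ba0 (psum0a (pone : E)).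
by apply: (summable1 (ea_axioms E)); exists t.
Qed.

Lemma ple_trans a b c : ple a b -> ple b c -> ple a c.
Proof.
move=> [u aub] [v bvc]; have [w _ awc] := psum_assoc aub bvc.
by exists w.
Qed.

Lemma ple_anti a b : ple a b -> ple b a -> a = b.
Proof.
move=> [u aub] [v bva]; have [w uvw awa] := psum_assoc aub bva.
have w0 := psum_cancel awa (psuma0 a); rewrite w0 in uvw.
by rewrite (psum_eq0 uvw) in aub; exact: psum_fun (psuma0 a) aub.
Qed.

Lemma ple_psum a b c : @psum E a b c -> ple a c.
Proof. by exists b. Qed.

Lemma ple_psumr a b c : @psum E a b c -> ple b c.
Proof. by move=> /psum_sym; exact: ple_psum. Qed.

Lemma ple_oc a b : ple a b -> ple (oc b) (oc a).
Proof.
move=> [c acb]; have [t cbt at1] := psum_assoc acb (psum_oc b).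
by exists c; rewrite -(oc_unique at1); exact: psum_sym.
Qed.

Lemma ple_ocr a b : ple a (oc b) -> ple b (oc a).
Proof. by move=> /ple_oc; rewrite ocK. Qed.

Lemma summable_ple a b : Defs.summable a b <-> ple a (oc b).
Proof.
split=> [[s /psum_sym bas]|[c acb]].
  have [t asb bt1] := psum_assoc bas (psum_oc s).
  by exists (oc s); rewrite -(oc_unique bt1).
have [s bas _] := psum_assocr acb (psum_oc b).
by exists s; exact: psum_sym.
Qed.

Lemma ple_psum2l a b c s t : @psum E a b s -> psum a c t ->
  ple s t <-> ple b c.
Proof.
move=> abs act; split=> [[d sdt]|[d bdc]].
  have [u bdu aut] := psum_assoc abs sdt.
  by exists d; rewrite (psum_cancel act aut).
have [u abu udt] := psum_assocr bdc act.
by exists d; rewrite (psum_fun abs abu).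
Qed.

Lemma oc1 : oc (pone : E) = pzero.
Proof. by apply/esym/oc_unique/psum10. Qed.

Lemma ple0_eq a : ple a pzero -> a = pzero.
Proof. by move=> ?; apply: ple_anti => //; exact: ple0. Qed.

Lemma is_glb_uniq (S : set E) a b :
  is_glb (@ple E) S a -> is_glb (@ple E) S b -> a = b.
Proof. by move=> [la ua] [lb ub]; apply: ple_anti; [exact: ub|exact: ua]. Qed.

Lemma is_lub_uniq (S : set E) a b :
  is_lub (@ple E) S a -> is_lub (@ple E) S b -> a = b.
Proof. by move=> [la ua] [lb ub]; apply: ple_anti; [exact: ua|exact: ub]. Qed.

Lemma is_lub_oc (S : set E) s :
  is_lub (@ple E) S s -> is_glb (@ple E) (@oc E @` S) (oc s).
Proof.
move=> [ubs lubs]; split=> [_ [a Sa <-]|b lb]; first by apply/ple_oc/ubs.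
by apply/ple_ocr/lubs => a Sa; apply/ple_ocr/lb; exists a.
Qed.

Lemma is_glb2P a b : is_glb (@ple E) [set a; b] pzero <->
  forall z, ple z a -> ple z b -> z = pzero.
Proof.
split=> [[_ glb] z za zb|ab0].
  by apply/ple0_eq/glb => _ [->|->].
split=> [c _|z lbz]; first exact: ple0.
have -> : z = pzero by apply: ab0; apply: lbz; [left|right].
exact: ple_refl.
Qed.

End EffectAlgebraBasics.

(** * The sharp elements of a sigma-MV-effect algebra *)

Section SharpElements.
Variables (E : effectAlgebra) (hE : is_sigma_MV_effect_algebra E).
Implicit Types a b c d s t z : E.

Definition meet a b : E := xget (pzero : {classic E}) (is_glb (@ple E) [set a; b]).

Definition csup (S : set E) : E := xget (pzero : {classic E}) (is_lub (@ple E) S).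

Lemma meet_glb a b : is_glb (@ple E) [set a; b] (meet a b).
Proof. by have [_ [m hm]] := hE.1.1 a b; exact: (@xgetI {classic E} _ _ m hm). Qed.

Lemma csup_lub (S : set E) : countable S -> is_lub (@ple E) S (csup S).
Proof.
move=> cS; have [[s hs] _] := hE.2 S cS.
exact: (@xgetI {classic E} _ _ s hs).
Qed.

Lemma meet_l a b : ple (meet a b) a.
Proof. by apply: (meet_glb a b).1; left. Qed.

Lemma meet_r a b : ple (meet a b) b.
Proof. by apply: (meet_glb a b).1; right. Qed.

Lemma ple_meet z a b : ple z a -> ple z b -> ple z (meet a b).
Proof. by move=> za zb; apply: (meet_glb a b).2 => _ [->|->]. Qed.

(** The lattice form of the MV condition; it replaces distributivity in all
    that follows. *)
Lemma meet0_ple a b : meet a b = pzero -> ple a (oc b).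
Proof.
by move=> ab0; apply/summable_ple/hE.1.2; rewrite -ab0; exact: meet_glb.
Qed.

Lemma meet_eq0P a b :
  meet a b = pzero <-> forall z, ple z a -> ple z b -> z = pzero.
Proof.
by rewrite -is_glb2P; split=> [<-|]; [exact: meet_glb|
  apply: is_glb_uniq; exact: meet_glb].
Qed.

Lemma disjoint_psum_lub a b c : meet a b = pzero -> psum a b c ->
  is_lub (@ple E) [set a; b] c.
Proof.
move=> /meet_eq0P ab0 abc; split=> [_ [->|->]|d ubd].
- exact: ple_psum abc.
- exact: ple_psumr abc.
(* Write c as e + z with e the meet of d and c, an upper bound of a and b;
   then z lies below both b and a. *)
have [z ezc] := meet_r d c.
have ae : ple a (meet d c) by apply: ple_meet; [apply: ubd; left|exact: ple_psum abc].
have be : ple b (meet d c) by apply: ple_meet; [apply: ubd; right|exact: ple_psumr abc].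
have below x y : psum x y c -> ple x (meet d c) -> ple z y.
  move=> xyc [u xue]; have [w uzw xwc] := psum_assoc xue ezc.
  by rewrite (psum_cancel xyc xwc); exact: ple_psumr uzw.
have z0 : z = pzero by apply: ab0; [apply: below (psum_sym abc) be|apply: below abc ae].
rewrite z0 in ezc; rewrite (psum_fun ezc (psuma0 _)).
exact: meet_l.
Qed.

Lemma sharpP a : sharp a <-> meet a (oc a) = pzero.
Proof. by rewrite meet_eq0P; exact: is_glb2P. Qed.

Lemma sharp_eq0 a z : sharp a -> ple z a -> ple z (oc a) -> z = pzero.
Proof. by move=> /is_glb2P; apply. Qed.

(** Sharp elements are the principal ones: the part of a sum of two elements
    below [a] that lies below [oc a] is disjoint from both summands, hence
    vanishes. *)
Lemma sharp_principal a b c s : sharp a -> ple b a -> ple c a -> psum b c s ->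
  ple s a.
Proof.
move=> sa ba ca bcs; rewrite -[a]ocK; apply/meet0_ple/meet_eq0P => d ds da'.
have db0 : meet d b = pzero.
  apply/meet_eq0P => z zd zb; apply: (sharp_eq0 sa).
    exact: ple_trans zb ba.
  exact: ple_trans zd da'.
have [u dbu] : Defs.summable d b by apply/summable_ple/meet0_ple.
have us : ple u s.
  apply: (disjoint_psum_lub db0 dbu).2 => _ [->//|->].
  exact: ple_psum bcs.
have dc := (ple_psum2l (psum_sym dbu) bcs).1 us.
by apply: (sharp_eq0 sa) => //; exact: ple_trans dc ca.
Qed.

Lemma sharp_glb (S : set E) m : (forall a, S a -> sharp a) ->
  is_glb (@ple E) S m -> sharp m.
Proof.
move=> sS [lbm glbm]; apply/is_glb2P => z zm /summable_ple [s zms].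
have sm : ple s m.
  apply: glbm => a Sa; apply: (sharp_principal (sS a Sa) _ _ zms).
    exact: ple_trans zm (lbm a Sa).
  exact: lbm.
apply: ple0_eq; apply/(ple_psum2l (psum_sym zms) (psuma0 m)).
exact: sm.
Qed.

Lemma sharp_lub (S : set E) s : (forall a, S a -> sharp a) ->
  is_lub (@ple E) S s -> sharp s.
Proof.
move=> sS /is_lub_oc lubs; rewrite -[s]ocK; apply: sharp_oc.
by apply: sharp_glb lubs => _ [a Sa <-]; apply/sharp_oc/sS.
Qed.

Lemma sharp_meet a b : sharp a -> sharp b -> sharp (meet a b).
Proof. by move=> sa sb; apply: sharp_glb (meet_glb a b) => _ [->|->]. Qed.

Lemma sharp_psum_meet0 a b c : sharp b -> psum a b c -> meet a b = pzero.
Proof.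
move=> sb abc; apply/meet_eq0P => z za zb; apply: (sharp_eq0 sb) => //.
by apply: ple_trans za _; apply/summable_ple; exists c.
Qed.

Lemma sharp_psum_lub a b c : sharp b -> psum a b c ->
  is_lub (@ple E) [set a; b] c.
Proof. by move=> sb abc; apply: disjoint_psum_lub (sharp_psum_meet0 sb abc) abc. Qed.

Lemma sharp_psum a b c : sharp a -> sharp b -> psum a b c -> sharp c.
Proof.
by move=> sa sb abc; apply: sharp_lub (sharp_psum_lub sb abc) => _ [->|->].
Qed.

End SharpElements.

(** * Ultrafilters of sharp elements and the Baire property *)

Section Ultrafilters.
Variables (E : effectAlgebra) (hE : is_sigma_MV_effect_algebra E).
Implicit Types (a b c d s t z : E) (U V : set E).

Record sharp_filter U : Prop := SharpFilter {
  filter_sharp : forall a, U a -> sharp a;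
  filter1 : U pone;
  filter0 : ~ U pzero;
  filter_meet : forall a b, U a -> U b -> U (meet a b);
  filter_up : forall a b, U a -> sharp b -> ple a b -> U b
}.

Record ultra U : Prop := Ultra {
  ultra_filter : sharp_filter U;
  ultra_oc : forall a, sharp a -> U a \/ U (oc a)
}.

Lemma ultra_meetE U a b : ultra U -> sharp a -> sharp b ->
  U (meet a b) <-> U a /\ U b.
Proof.
move=> [fU _] sa sb; split=> [Uab|[Ua Ub]]; last exact: filter_meet.
by split; apply: filter_up Uab _ _ => //; [exact: meet_l|exact: meet_r].
Qed.

Lemma ultra_ocE U a : ultra U -> sharp a -> U (oc a) <-> ~ U a.
Proof.
move=> uU sa; split=> [Ua' Ua|nUa]; last by case: (ultra_oc uU sa).
have := filter_meet (ultra_filter uU) Ua Ua'.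
by rewrite (sharpP hE a).1//; exact: filter0 (ultra_filter uU).
Qed.

(** A filter maximal among those containing [F] decides every sharp element:
    if neither [a] nor [oc a] could be added, then some member would be
    disjoint from both, hence zero. *)
Lemma ultra_extension (F : set E) : sharp_filter F ->
  exists2 U, ultra U & F `<=` U.
Proof.
move=> fF.
pose P V := sharp_filter (F `|` V).
have [C CP Ctot|A [PA maxA]] := @Zorn_bigcup E P.
  have two a b : (F `|` \bigcup_(X in C) X) a -> (F `|` \bigcup_(X in C) X) b ->
      exists V, [/\ V `<=` \bigcup_(X in C) X, sharp_filter (F `|` V),
                    (F `|` V) a & (F `|` V) b].
    have F0 : sharp_filter (F `|` set0) by rewrite setU0.
    have CU X : C X -> X `<=` \bigcup_(X in C) X by move=> CX x; exists X.
    case=> [Fa|[X CX Xa]]; case=> [Fb|[Y CY Yb]].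
    - by exists set0; split=> //; left.
    - by exists Y; split; [exact: CU|exact: CP|left|right].
    - by exists X; split; [exact: CU|exact: CP|right|left].
    - have [XY|YX] := Ctot X Y CX CY.
        by exists Y; split; [exact: CU|exact: CP|right; exact: XY|right].
      by exists X; split; [exact: CU|exact: CP|right|right; exact: YX].
  split.
  - by move=> a Ua; have [V [_ fV Va _]] := two a a Ua Ua; exact: filter_sharp fV _ Va.
  - by left; exact: filter1 fF.
  - by move=> U0; have [V [_ fV V0 _]] := two _ _ U0 U0; exact: filter0 fV V0.
  - move=> a b Ua Ub; have [V [VU fV Va Vb]] := two a b Ua Ub.
    by case: (filter_meet fV Va Vb); [left|move=> /VU; right].
  - move=> a b Ua sb ab; have [V [VU fV Va _]] := two a a Ua Ua.
    by case: (filter_up fV Va sb ab); [left|move=> /VU; right].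
exists (F `|` A); last by move=> x; left.
split=> // a sa; apply: contrapT => /not_orP [na na'].
have escape e : sharp e -> ~ (F `|` A) e ->
    exists2 u, (F `|` A) u & meet u e = pzero.
  move=> se ne; apply: contrapT => nu.
  pose V : set E := [set c | sharp c /\ exists2 u, (F `|` A) u & ple (meet u e) c].
  have sub : F `|` A `<=` V.
    move=> u FAu; split; first exact: filter_sharp PA _ FAu.
    by exists u => //; exact: meet_l.
  have Ve : V e by split=> //; exists pone; [exact: filter1 PA|exact: meet_r].
  apply: (maxA V).
    split; first by move=> x Ax; apply: sub; right.
    by move=> VA; apply: ne; right; exact: VA.
  rewrite /P (_ : F `|` V = V); last first.
    by apply/seteqP; split=> [x [Fx|//]|x Vx]; [apply: sub; left|right].
  split.
  - by move=> c [].
  - by apply: sub; exact: filter1 PA.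
  - by move=> [_ [u FAu /ple0_eq u0]]; apply: nu; exists u.
  - move=> c d [sc [u FAu uc]] [sd [v FAv vd]]; split; first exact: sharp_meet.
    exists (meet u v); first exact: filter_meet.
    apply: ple_meet => //.
      apply: ple_trans uc; apply: ple_meet => //; last exact: meet_r.
      by apply: ple_trans (meet_l hE u v); exact: meet_l.
    apply: ple_trans vd; apply: ple_meet => //; last exact: meet_r.
    by apply: ple_trans (meet_r hE u v); exact: meet_l.
  - move=> c d [sc [u FAu uc]] sd cd; split=> //.
    by exists u => //; exact: ple_trans uc cd.
have [u FAu /(meet0_ple hE) ua] := escape _ sa na.
have [v FAv /(meet0_ple hE)] := escape _ (sharp_oc sa) na'.
rewrite ocK => va.
have := filter_meet PA FAu FAv.
rewrite (@sharp_eq0 _ a (meet u v))//; first exact: filter0 PA.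
  by apply: ple_trans va; exact: meet_r.
by apply: ple_trans ua; exact: meet_l.
Qed.

(** The sharp elements [c] stand for the basic clopen sets [{U | U c}] of the
    Stone space, so this is nowhere density there. *)
Definition nowhere_dense (N : set (set E)) : Prop :=
  forall b, sharp b -> b <> pzero ->
    exists c, [/\ sharp c, c <> pzero, ple c b &
                  forall U, ultra U -> U c -> ~ N U].

(** The comeagre filter of the Stone space. Points are arbitrary subsets of
    [E], of which only the ultrafilters count, so that the space of points is a
    pointed type even when there is no ultrafilter, that is, when [0 = 1]. *)
Definition ae (P : set (set E)) : Prop :=
  exists N : nat -> set (set E), (forall n, nowhere_dense (N n)) /\
    forall U, ultra U -> (forall n, ~ N n U) -> P U.

Lemma nowhere_dense0 : nowhere_dense set0.
Proof. by move=> b sb b0; exists b; split=> //; [exact: ple_refl|move=> U _ _ []]. Qed.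

Lemma ae_ultra : ae ultra.
Proof. by exists (fun=> set0); split=> [n|//]; exact: nowhere_dense0. Qed.

Lemma ae_nat (P : nat -> set (set E)) :
  (forall n, ae (P n)) -> ae (fun U => forall n, P n U).
Proof.
move=> /choice [N hN].
exists (fun k => if unpickle k is Some (n, m) then N n m else set0).
split=> [k|U uU hU n]; first by case: unpickle => [[n m]|];
  [exact: (hN n).1|exact: nowhere_dense0].
by apply: (hN n).2 => // m; have := hU (pickle (n, m)); rewrite pickleK.
Qed.

Lemma ae_all (I : countType) (P : I -> set (set E)) :
  (forall i, ae (P i)) -> ae (fun U => forall i, P i U).
Proof.
move=> aeP.
have [N [ndN hN]] : ae (fun U => forall n,
    if @unpickle I n is Some i then P i U else True).
  apply: ae_nat => n; case: unpickle => [i|]; first exact: aeP.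
  by exists (fun=> set0); split=> [m|//]; exact: nowhere_dense0.
exists N; split=> // U uU NU i.
by have := hN U uU NU (pickle i); rewrite pickleK.
Qed.

#[global] Instance ae_filter : Filter ae.
Proof.
split.
- by exists (fun=> set0); split=> [n|//]; exact: nowhere_dense0.
- move=> P Q aeP aeQ.
  have [|N [ndN hN]] := @ae_nat (fun n => if n is 0%N then P else Q); first by case.
  by exists N; split=> // U uU NU; split;
    [exact: (hN U uU NU 0%N)|exact: (hN U uU NU 1%N)].
- by move=> P Q PQ [N [ndN hN]]; exists N; split=> // U uU NU; exact/PQ/hN.
Qed.

(** Baire category theorem: meet ever smaller basic sets, each avoiding one more
    nowhere dense set, with an ultrafilter. *)
Lemma ae_witness (P : set (set E)) b : ae P -> sharp b -> b <> pzero ->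
  exists U, [/\ ultra U, U b & P U].
Proof.
move=> [N [ndN hN]] sb b0.
pose nz := {c : E | sharp c /\ c <> pzero}.
have step (nc : nat * nz) : exists d : nz, ple (sval d) (sval nc.2) /\
    forall U, ultra U -> U (sval d) -> ~ N nc.1 U.
  case: nc => n [c [sc c0]] /=.
  by have [d [sd d0 dc dN]] := ndN n c sc c0; exists (exist _ d (conj sd d0)).
have [next hnext] := choice step.
pose w := fix w n : nz := if n is m.+1 then next (m, w m)
                          else exist _ b (conj sb b0).
have wdec n m : (n <= m)%N -> ple (sval (w m)) (sval (w n)).
  elim: m => [|m IH]; first by rewrite leqn0 => /eqP ->; exact: ple_refl.
  rewrite leq_eqVlt => /orP[/eqP ->|]; first exact: ple_refl.
  by rewrite ltnS => /IH; apply: ple_trans; exact: (hnext (m, w m)).1.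
pose F : set E := [set c | sharp c /\ exists n, ple (sval (w n)) c].
have fF : sharp_filter F.
  split.
  - by move=> a [].
  - by split; [exact: sharp1|exists 0%N; exact: ple1].
  - by move=> [_ [n /ple0_eq w0]]; exact: (svalP (w n)).2.
  - move=> a c [sa [n wa]] [sc [m wc]]; split; first exact: sharp_meet.
    exists (maxn n m); apply: ple_meet => //.
      by apply: ple_trans wa; apply: wdec; exact: leq_maxl.
    by apply: ple_trans wc; apply: wdec; exact: leq_maxr.
  - move=> a c [sa [n wa]] sc ac; split=> //.
    by exists n; exact: ple_trans wa ac.
have [U uU FU] := ultra_extension fF.
have Uw n : U (sval (w n)).
  by apply: FU; split; [exact: (svalP (w n)).1|exists n; exact: ple_refl].
exists U; split=> //; first exact: (Uw 0%N).
by apply: hN => // n; apply: (hnext (n, w n)).2 => //; exact: (Uw n.+1).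
Qed.

Lemma ae_ple a b : sharp a -> sharp b ->
  ae (fun U => U a -> U b) -> ple a b.
Proof.
move=> sa sb aeab; rewrite -[b]ocK; apply: (meet0_ple hE); apply: contrapT => ab0.
have sb' := sharp_oc sb.
have [U [uU]] := ae_witness aeab (sharp_meet hE sa sb') ab0.
by rewrite ultra_meetE// => -[Ua] /(ultra_ocE uU sb) nUb /(_ Ua).
Qed.

(** Ultrafilters outside a nowhere dense set commute with a given join: a
    nonzero [b] meets the complement of the join or one of its members. *)
Lemma ae_lub (S : set E) s : (forall a, S a -> sharp a) ->
  is_lub (@ple E) S s -> ae (fun U => U s <-> exists2 a, S a & U a).
Proof.
move=> sS lubs; have ss := sharp_lub hE sS lubs.
exists (fun=> [set U | U s /\ forall a, S a -> ~ U a]).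
split=> [_|U uU /(_ 0%N) nU]; last first.
  split=> [Us|[a Sa Ua]].
    apply: contrapT => nex; apply: nU; split=> // a Sa Ua.
    by apply: nex; exists a.
  by apply: (filter_up (ultra_filter uU) Ua ss); exact: lubs.1.
move=> b sb b0; have [bs0|bs0] := pselect (meet b (oc s) = pzero).
  have [[a [Sa ba0]]|nex] := pselect (exists a, S a /\ meet b a <> pzero).
    have sa := sS a Sa.
    exists (meet b a); split=> //; [exact: sharp_meet|exact: meet_l|].
    by move=> U uU; rewrite ultra_meetE// => -[_ Ua] [_ /(_ a Sa)].
  exfalso; apply: b0; apply: (sharp_eq0 ss).
    by rewrite -[s]ocK; exact: meet0_ple.
  apply/ple_ocr/lubs.2 => a Sa; apply: ple_ocr; apply: (meet0_ple hE).
  apply: contrapT => ba0.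
  by apply: nex; exists a.
exists (meet b (oc s)); split=> //.
- exact/(sharp_meet hE)/sharp_oc.
- exact: meet_l.
- move=> U uU; rewrite ultra_meetE//; last exact: sharp_oc.
  by move=> [_ /(ultra_ocE uU ss) nUs] [].
Qed.

End Ultrafilters.

(** * Subsets of the Stone space representing sharp elements *)

Lemma countable_image (I T : Type) (D : set I) (f : I -> T) :
  countable D -> countable (f @` D).
Proof. exact/card_le_trans/card_image_le. Qed.

Lemma countable_enumeration (T : Type) (S : set T) : countable S -> S !=set0 ->
  exists u : nat -> T, range u = S.
Proof.
move=> /countable_injP [f finj] [x0 Sx0].
have /choice [u hu] (n : nat) : exists x, S x /\ forall y, S y -> f y = n -> y = x.
  have [[x [Sx fx]]|nx] := pselect (exists x, S x /\ f x = n).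
    exists x; split=> // y Sy fy; apply: finj; rewrite ?inE//.
    by rewrite fx fy.
  by exists x0; split=> // y Sy fy; exfalso; apply: nx; exists y.
exists u; apply/seteqP; split=> [_ [n _ <-]|x Sx]; first by case: (hu n).
by exists (f x) => //; apply/esym; apply: (hu (f x)).2.
Qed.

Section Representation.
Variables (E : effectAlgebra) (hE : is_sigma_MV_effect_algebra E).
Implicit Types (a b c s : E) (A B C : set (set E)).

Definition rep A a : Prop := sharp a /\ ae (fun U => A U <-> U a).

Definition representable : set (set (set E)) := [set A | exists a, rep A a].

Lemma rep_ple A B a b : rep A a -> rep B b ->
  ple a b <-> ae (fun U => A U -> B U).
Proof.
move=> [sa aeA] [sb aeB]; split=> [ab|aeAB].
  have := ae_ultra E; apply: filterS3 aeA aeB => U AU BU uU /AU Ua.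
  by apply/BU; apply: (filter_up (ultra_filter uU) Ua sb).
apply: (ae_ple hE) => //; apply: filterS3 aeA aeB aeAB => U AU BU ABU.
by move=> /AU/ABU/BU.
Qed.

Lemma rep_ae A B a : rep A a -> ae (fun U => A U <-> B U) -> rep B a.
Proof.
move=> [sa aeA] aeAB; split=> //; apply: filterS2 aeA aeAB => U AU BU.
by rewrite -BU.
Qed.

Lemma rep_uniq A a b : rep A a -> rep A b -> a = b.
Proof.
move=> ra rb.
by apply: ple_anti; [apply/(rep_ple ra rb)|apply/(rep_ple rb ra)];
  apply: filterE => U.
Qed.

Lemma rep_sharp a : sharp a -> rep [set U | U a] a.
Proof. by move=> sa; split=> //; exact: filterE. Qed.

Lemma rep_oc A a : rep A a -> rep (~` A) (oc a).
Proof.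
move=> [sa aeA]; split; first exact: sharp_oc.
have := ae_ultra E; apply: filterS2 aeA => U AU uU.
by rewrite (ultra_ocE hE uU sa) -AU.
Qed.

Lemma rep_setT : rep setT (pone : E).
Proof.
split; first exact: sharp1.
by have := ae_ultra E; apply: filterS => U [fU _]; split=> // _; exact: filter1 fU.
Qed.

Lemma rep_set0 : rep set0 (pzero : E).
Proof. by rewrite -setCT -(oc1 E); exact/rep_oc/rep_setT. Qed.

Lemma rep_bigcup (A : nat -> set (set E)) (a : nat -> E) s :
  (forall n, rep (A n) (a n)) -> is_lub (@ple E) (range a) s ->
  rep (\bigcup_n A n) s.
Proof.
move=> rA lubs.
have sR c : range a c -> sharp c by move=> [n _ <-]; exact: (rA n).1.
split; first exact: (sharp_lub hE sR lubs).
have aeA := ae_nat (fun n => (rA n).2).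
apply: filterS2 aeA (ae_lub hE sR lubs) => U AU ->.
split=> [[n _ /AU Un]|[_ [n _ <-] /AU Un]]; last by exists n.
by exists (a n).
Qed.

Lemma ae_psum a b c : sharp a -> sharp b -> psum a b c ->
  ae (fun U => U c <-> U a \/ U b).
Proof.
move=> sa sb abc; have sab d : [set a; b] d -> sharp d by move=> [->|->].
have aec := ae_lub hE sab (sharp_psum_lub hE sb abc).
apply: filterS aec => U ->; split=> [[d [->|->]]|[Ua|Ub]]; [by left|by right| |].
  by exists a => //; left.
by exists b => //; right.
Qed.

Lemma rep_psum A B C a b c : rep A a -> rep B b -> rep C c ->
  A `&` B = set0 -> C = A `|` B -> psum a b c.
Proof.
move=> ra rb rc AB0 CAB.
have [d abd] : Defs.summable a b.
  apply/summable_ple/(rep_ple ra (rep_oc rb)); apply: filterE => U AU BU.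
  by have : (A `&` B) U by []; rewrite AB0.
suff : rep C d by move=> /(rep_uniq rc) ->.
have [[sa aeA] [sb aeB]] := (ra, rb); split; first exact: (sharp_psum hE sa sb abd).
rewrite CAB; apply: filterS3 aeA aeB (ae_psum sa sb abd) => U AU BU ->.
by rewrite -AU -BU.
Qed.

(** Loomis-Sikorski: up to meagre sets, sharp elements form a sigma-algebra of
    sets. *)
Lemma sigma_algebra_representable : sigma_algebra setT representable.
Proof.
split.
- by exists pzero; exact: rep_set0.
- by move=> A [a rA]; exists (oc a); rewrite setTD; exact: rep_oc.
- move=> A /choice [a rA]; exists (csup (range a)).
  by apply: rep_bigcup rA _; apply: (csup_lub hE); exact: countable_image.
Qed.

End Representation.

Definition stone (E : effectAlgebra) : measurableType _ :=
  g_sigma_algebraType (@representable E).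

(** * Sharp observables as measurable functions on the Stone space *)

Section ObservableBasics.
Variables (R : realType) (E : effectAlgebra).
Implicit Types (x y z : observable R E) (A B : borel R).

Lemma borel_inj A B : sval A = sval B -> A = B.
Proof. by case: A B => [A mA] [B mB] /= AB; exact: eq_exist. Qed.

Lemma observable_inj x y : (forall A, x A = y A) -> x = y.
Proof.
case: x y => [x px] [y py] /= xy; have {}xy : x = y by apply/funext.
by rewrite xy in px *; congr Observable; exact: Prop_irrelevance.
Qed.

Lemma obs_setD x A B C : sval B `<=` sval A -> sval C = sval A `\` sval B ->
  psum (x B) (x C) (x A).
Proof.
move=> BA CAB; apply: (obsU (obs_axioms x)); rewrite CAB.
  by rewrite setIDA setIC -setIDA setDv setI0.
by rewrite setDUK.
Qed.

Lemma obs_mono x A B : sval A `<=` sval B -> ple (x A) (x B).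
Proof.
move=> AB; apply: (ple_psum (b := x (exist _ _ (measurableD (svalP B) (svalP A))))).
exact: obs_setD.
Qed.

(** The rays are stable under intersection and generate the Borel sets, and the
    Borel sets where two observables agree form a Dynkin class. *)
Lemma obs_ext x y : (forall t, spec x t = spec y t) -> x = y.
Proof.
move=> xy; apply: observable_inj => -[A mA].
pose H := [set A : set R | forall mA : measurable A, x (exist _ A mA) = y (exist _ A mA)].
pose L := [set A : set R | measurable A /\ H A].
suff : (@RGenInftyO.G R).-sigma.-measurable `<=` L.
  by rewrite -RGenInftyO.measurableE => /(_ A mA) [_]; exact.
apply: lambda_system_subset => //.
- move=> _ _ [s ->] [t ->]; exists (Num.min s t).
  apply/seteqP; split=> r; rewrite /= !in_itv /= lt_min; first by case=> -> ->.
  by move=> /andP[].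
- split=> //.
  + split=> // mT; rewrite (obsT (obs_axioms x))// (obsT (obs_axioms y))//.
  + move=> B C CB [mB HB] [mC HC]; split; first exact: measurableD.
    move=> mBC.
    have xD := @obs_setD x (exist _ _ mB) (exist _ _ mC) (exist _ _ mBC) CB erefl.
    have yD := @obs_setD y (exist _ _ mB) (exist _ _ mC) (exist _ _ mBC) CB erefl.
    by rewrite HB HC in xD; exact: psum_cancel xD yD.
  + move=> F ndF LF; have mF n := (LF n).1; have HF n := (LF n).2.
    split; first exact: bigcup_measurable.
    move=> mU; pose F' n : borel R := exist _ (F n) (mF n).
    have inc i : sval (F' i) `<=` sval (F' i.+1).
      by have /subsetPset := ndF i i.+1 (leqnSn i).
    have xU := @obs_lub _ _ _ (obs_axioms x) F' (exist _ _ mU) inc erefl.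
    have yU := @obs_lub _ _ _ (obs_axioms y) F' (exist _ _ mU) inc erefl.
    apply: is_lub_uniq xU _; rewrite (_ : (fun i => x (F' i)) = fun i => y (F' i))//.
    by apply/funext => i; exact: HF.
- move=> _ [t ->]; split; first exact: measurable_itv.
  move=> mt; have := xy t; rewrite /spec.
  by rewrite (@borel_inj (borel_itv _) (exist _ _ mt)).
Qed.

Lemma spec_left_lub x t :
  is_lub (@ple E) (range (fun n => spec x (t - n.+1%:R^-1))) (spec x t).
Proof.
apply: (obs_lub (obs_axioms x)) => [n r|].
  rewrite /= !in_itv /= => /lt_le_trans; apply; rewrite lerD2l lerN2.
  by rewrite lef_pV2 ?posrE// ler_nat.
apply/seteqP; split=> r /=; rewrite !in_itv /=.
  move=> [n _] /=; rewrite in_itv /= => /lt_trans; apply.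
  by rewrite ltrBlDr ltrDl.
move=> /ltr_add_invr [n rnt]; exists n => //=.
by rewrite in_itv /= ltrBrDr.
Qed.

End ObservableBasics.

Section FunctionsAndObservables.
Variables (R : realType) (E : effectAlgebra).
Hypothesis hE : is_sigma_MV_effect_algebra E.
Implicit Types (f g h : stone E -> R) (x y z : observable R E) (a b : E).

(** The observable as the distribution of a random variable [f], where events
    modulo meagre sets take the place of probabilities. *)
Definition Rep f x : Prop := forall A : borel R, rep (f @^-1` sval A) (x A).

Definition ae_bounded f : Prop :=
  exists alpha beta : R, ae (fun U => alpha <= f U <= beta).

Lemma measurable_stoneP (A : set (stone E)) :
  measurable A <-> exists a, rep A a.
Proof.
change (<<s @representable E >> A <-> representable A).
by rewrite sigma_algebra_id//; exact: sigma_algebra_representable.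
Qed.

Lemma observable_of_fun f : measurable_fun setT f -> exists x, Rep f x.
Proof.
move=> mf.
have /choice [x hx] (A : borel R) : exists a, rep (f @^-1` sval A) a.
  apply/measurable_stoneP; rewrite -[X in measurable X]setTI.
  by apply: mf => //; exact: (svalP A).
suff ox : is_observable x by exists (Observable ox).
split.
- move=> A AT; apply: (rep_uniq hE (hx A)).
  by rewrite AT preimage_setT; exact: rep_setT.
- move=> A B C AB0 CAB; apply: (rep_psum hE (hx A) (hx B) (hx C)) => //.
    by rewrite -preimage_setI AB0 preimage_set0.
  by rewrite CAB preimage_setU.
- move=> A_ A Ai AU.
  have lubs := csup_lub hE (countable_image (fun i => x (A_ i)) (countableP setT)).
  have := rep_bigcup hE (fun n => hx (A_ n)) lubs.
  by rewrite -preimage_bigcup AU => /(rep_uniq hE (hx A)) ->.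
Qed.

Lemma Rep_spec f x t : Rep f x -> rep [set U | f U < t] (spec x t).
Proof. exact. Qed.

Lemma Rep_uniq f x y : Rep f x -> Rep f y -> x = y.
Proof.
move=> fx fy; apply: observable_inj => A.
exact: (rep_uniq hE (fx A) (fy A)).
Qed.

Lemma Rep_ae f g x : Rep f x -> ae (fun U => f U = g U) -> Rep g x.
Proof.
move=> fx fg A; apply: rep_ae (fx A) _.
by apply: filterS fg => U; rewrite /preimage /= => ->.
Qed.

Lemma Rep_sharp f x : Rep f x -> sharp_obs x.
Proof. by move=> fx A; have [] := fx A. Qed.

Lemma Rep_comp f x (k : R -> R) (mk : measurable_fun setT k) :
  Rep f x -> Rep (k \o f) (obs_comp mk x).
Proof. by move=> fx A; have := fx (borel_preimage mk A); rewrite /= setTI. Qed.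

Lemma olsonP f g x y : Rep f x -> Rep g y ->
  olson x y <-> ae (fun U => f U <= g U).
Proof.
move=> fx gy; split=> [xy|fg t]; last first.
  apply/(rep_ple hE (Rep_spec t gy) (Rep_spec t fx)).
  by apply: filterS fg => U /le_lt_trans; apply.
have /ae_all : forall r : rat, ae (fun U => g U < ratr r -> f U < ratr r).
  by move=> r; apply/(rep_ple hE (Rep_spec _ gy) (Rep_spec _ fx)).
apply: filterS => U gf; rewrite leNgt; apply/negP => /rat_in_itvoo [r].
by rewrite in_itv /= => /andP[/gf fr /(lt_trans fr)]; rewrite ltxx.
Qed.

Lemma observable_eqP f g x y : Rep f x -> Rep g y ->
  x = y <-> ae (fun U => f U = g U).
Proof.
move=> fx gy; split=> [xy|/(Rep_ae fx) /Rep_uniq]; last by apply.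
have le_xy : olson x y by rewrite xy; exact: olson_refl.
have le_yx : olson y x by rewrite xy; exact: olson_refl.
move: le_xy le_yx => /(olsonP fx gy) fg /(olsonP gy fx) gf.
by apply: filterS2 fg gf => U fg gf; apply/le_anti; rewrite fg gf.
Qed.

Lemma bounded_obsP f x : Rep f x -> bounded_obs x <-> ae_bounded f.
Proof.
move=> fx.
have eq1 A : x A = pone <-> ae (fun U => (sval A) (f U)).
  split=> [xA1|aeA].
    have [_] := fx A; rewrite xA1.
    by apply: filterS2 (ae_ultra E) => U uU fU; apply/fU/(filter1 (ultra_filter uU)).
  apply: (rep_uniq hE (fx A)); apply: rep_ae (rep_setT E) _.
  by apply: filterS aeA => U.
split=> -[alpha [beta]] h; exists alpha, beta.
  by have := (eq1 _).1 h; apply: filterS => U /=; rewrite in_itv.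
by apply/eq1; apply: filterS h => U /=; rewrite in_itv.
Qed.

Lemma spec_eq0 x alpha beta t : x (borel_itv `[alpha, beta]) = pone ->
  t <= alpha -> spec x t = pzero.
Proof.
move=> x1 ta; apply: (summable1 (ea_axioms E)); rewrite -x1.
exists (x (exist _ _ (measurableU _ _ (svalP (borel_itv `]-oo, t[))
  (svalP (borel_itv `[alpha, beta]))))).
apply: (obsU (obs_axioms x)) => //=; rewrite -subset0 => r /= [].
by rewrite !in_itv /= => rt /andP[ar _]; have := lt_le_trans rt (le_trans ta ar);
   rewrite ltxx.
Qed.

Lemma spec_eq1 x alpha beta t : x (borel_itv `[alpha, beta]) = pone ->
  beta < t -> spec x t = pone.
Proof.
move=> x1 bt; apply: ple_anti; first exact: ple1.
rewrite -x1; apply: obs_mono => r /=; rewrite !in_itv /= => /andP[_ rb].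
exact: le_lt_trans rb bt.
Qed.

(** The function of [x] at an ultrafilter [U] is the level at which the
    spectral resolution enters [U]. Left continuity of the resolution makes
    each of its sublevel sets right almost everywhere, and an observable is
    determined by its spectral resolution. *)
Lemma fun_of_observable x : sharp_obs x -> bounded_obs x ->
  exists2 f, measurable_fun setT f & Rep f x.
Proof.
move=> sx [alpha [beta x1]].
pose f (U : stone E) : R := sup [set t | ~ U (spec x t)].
have repf t : rep [set U | f U < t] (spec x t).
  split; first exact: sx.
  have aelub : ae (fun U => U (spec x t) <->
      exists2 a, range (fun n => spec x (t - n.+1%:R^-1)) a & U a).
    by apply: (ae_lub hE) (spec_left_lub x t) => _ [n _ <-]; exact: sx.
  apply: filterS2 (ae_ultra E) aelub => U uU Ulub.
  have fU := ultra_filter uU.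
  have up r s : U (spec x r) -> r <= s -> U (spec x s).
    move=> Ur rs; apply: (filter_up fU Ur); first exact: sx.
    apply: obs_mono => q /=; rewrite !in_itv /= => qr.
    exact: lt_le_trans qr rs.
  have ubU r : U (spec x r) -> ubound [set t | ~ U (spec x t)] r.
    by move=> Ur s /= nUs; rewrite leNgt; apply/negP => /ltW /(up _ _ Ur).
  have hub : has_ubound [set t | ~ U (spec x t)].
    exists (beta + 1); apply: ubU; rewrite (spec_eq1 x1) ?ltrDl//.
    exact: filter1 fU.
  have ne : [set t | ~ U (spec x t)] !=set0.
    by exists alpha; rewrite /= (spec_eq0 x1)//; exact: filter0 fU.
  split=> [ft|/Ulub [_ [n _ <-]] /ubU ub].
    apply: contrapT => nUt; move: ft; rewrite /= ltNge => /negP; apply.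
    exact: ub_le_sup.
  apply: le_lt_trans (ge_sup ne ub) _.
  by rewrite ltrBlDr ltrDl.
have mf : measurable_fun setT f.
  apply: (measurability _ (RGenInftyO.measurableE R)) => _ [_ [t ->] <-].
  rewrite setTI; apply/measurable_stoneP; exists (spec x t).
  exact: repf.
exists f => //; have [y fy] := observable_of_fun mf.
suff -> : x = y by [].
by apply: obs_ext => t; exact: (rep_uniq hE (repf t) (Rep_spec t fy)).
Qed.

(** The spectral formula for the sum of observables is, pointwise on the Stone
    space, the description of the event [f + g < t] as the union over rational
    [r] of the events [f < r] and [g < t - r]. *)
Lemma Rep_obs_sum f g x y z : Rep f x -> Rep g y -> Rep (f \+ g) z ->
  bounded_obs z -> obs_sum x y z.
Proof.
move=> fx gy fgz bz.
have sumP t : is_lub (@ple E)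
    [set m | exists r : rat, is_glb (@ple E)
      [set spec x (ratr r); spec y (t - ratr r)] m] (spec z t).
  set S := (X in is_lub _ X _).
  pose m (r : rat) := meet (spec x (ratr r)) (spec y (t - ratr r)).
  have SE : S = range m.
    apply/seteqP; split=> [c [r hr]|_ [r _ <-]]; last by exists r; exact: (meet_glb hE).
    by exists r => //; apply: is_glb_uniq hr; exact: (meet_glb hE).
  have sx := Rep_sharp fx; have sy := Rep_sharp gy.
  have sm c : S c -> sharp c by rewrite SE => -[r _ <-];
    apply: (sharp_meet hE); [exact: sx|exact: sy].
  have lubS : is_lub (@ple E) S (csup S).
    by apply: (csup_lub hE); rewrite SE; apply: countable_image; exact: countableP.
  suff repS : rep [set U | f U + g U < t] (csup S).
    by rewrite (rep_uniq hE (Rep_spec t fgz) repS).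
  split; first exact: (sharp_lub hE sm lubS).
  have aef : ae (fun U => forall r : rat, f U < ratr r <-> U (spec x (ratr r))).
    by apply: ae_all => r; exact: (Rep_spec _ fx).2.
  have aeg : ae (fun U => forall r : rat, g U < t - ratr r <-> U (spec y (t - ratr r))).
    by apply: ae_all => r; exact: (Rep_spec _ gy).2.
  have aeS := [elaborate filterI (ae_ultra E) (ae_lub hE sm lubS)].
  apply: filterS3 aef aeg aeS => U xU yU [uU SU]; apply: iff_trans (iff_sym SU).
  rewrite SE; split=> /= [|[_ [r _ <-]]].
    rewrite -ltrBrDr => /rat_in_itvoo [r]; rewrite in_itv /= => /andP[fr rg].
    exists (m r); first by exists r.
    apply/(ultra_meetE hE uU (sx _) (sy _)); split; first exact/xU.
    by apply/yU; rewrite /= ltrBrDr addrC -ltrBrDr.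
  move=> /(ultra_meetE hE uU (sx _) (sy _)) [/xU fr /yU gr].
  by rewrite -ltrBrDr (lt_trans fr)// ltrBrDr addrC -ltrBrDr.
split=> // w [bw sumw]; apply: obs_ext => t.
by apply: is_lub_uniq (sumP t) (sumw t).
Qed.

Lemma obs_sum_uniq x y z z' : obs_sum x y z -> obs_sum x y z' -> z = z'.
Proof. by move=> [_ zU] [hz' _]; exact: zU. Qed.

Lemma Rep_question a : sharp a -> Rep (fun U => (`[< U a >])%:R) (question R a).
Proof.
move=> sa A; have ra := rep_sharp sa.
rewrite /= /question_fun; case: ifPn => A1; case: ifPn => A0;
  [have := rep_setT E|have := ra|have := rep_oc hE ra|have := rep_set0 hE];
  congr rep; apply/seteqP; split=> U; rewrite /preimage /=;
  move: A1 A0; rewrite ?inE ?notin_setE; case: asboolP => //.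
Qed.

End FunctionsAndObservables.

(** * Questions *)

Section Questions.
Variables (R : realType) (E : effectAlgebra).
Hypothesis hE : is_sigma_MV_effect_algebra E.
Implicit Types (f g : stone E -> R) (x y z w : observable R E) (a b c : E).

Lemma spec_question a (t : R) : spec (question R a) t =
  if 1 < t then pone else if 0 < t then oc a else pzero.
Proof.
rewrite /spec /= /question_fun /= !mem_setE !in_itv /=.
by case: (ltP 1 t) => // /(lt_trans ltr01) ->.
Qed.

Lemma question_at1 a : question R a (borel_itv `[1, 1]) = a.
Proof. by rewrite /= /question_fun /= !mem_setE !in_itv /= lexx ler10. Qed.

Lemma Rep_question0 : Rep (fun=> 0) (question R (pzero : E)).
Proof.
apply: (Rep_ae (Rep_question hE (sharp0 E))).
apply: filterS (ae_ultra E) => U [fU _].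
by case: asboolP => // U0; case: (filter0 fU).
Qed.

Lemma Rep_question1 : Rep (fun=> 1) (question R (pone : E)).
Proof.
apply: (Rep_ae (Rep_question hE (sharp1 E))).
apply: filterS (ae_ultra E) => U [fU _].
by case: asboolP => //; case; exact: filter1 fU.
Qed.

Lemma question_sum a b c : sharp a -> sharp b -> psum a b c ->
  obs_sum (question R a) (question R b) (question R c).
Proof.
move=> sa sb abc; have sc := sharp_psum hE sa sb abc.
apply: (Rep_obs_sum hE (Rep_question hE sa) (Rep_question hE sb)); last first.
  exact: question_bounded.
apply: (Rep_ae (Rep_question hE sc)).
have ab' : ple a (oc b) by apply/summable_ple; exists c.
have disj : ae (fun U => U a -> ~ U b).
  have sb' := sharp_oc sb.
  have := (rep_ple hE (rep_sharp sa) (rep_sharp sb')).1 ab'.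
  apply: filterS2 (ae_ultra E) => U uU ab /ab.
  exact: (ultra_ocE hE uU sb).1.
apply: filterS2 disj (ae_psum hE sa sb abc) => U nab Uc /=.
case: (asboolP (U c)) => [/Uc|nc].
  case: (asboolP (U a)) => [/nab nb _|nUa]; first by rewrite (asboolF nb) /= addr0.
  by case=> // Ub; rewrite asboolT//= add0r.
by rewrite !asboolF //= ?addr0// => h; apply/nc/Uc; [right|left].
Qed.

(** Such an [f] is almost everywhere the indicator of the event [f = 1]. *)
Lemma Rep_zero_one f x : Rep f x -> ae (fun U => f U = 0 \/ f U = 1) ->
  x = question R (x (borel_itv `[1, 1])).
Proof.
move=> fx f01; set a := x _.
have [sa aea] : rep (f @^-1` `[1, 1]) a by exact: fx.
apply: (Rep_uniq hE fx); apply: (Rep_ae (Rep_question hE sa)).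
apply: filterS2 f01 aea => U fU; rewrite /preimage /= in_itv /= => aU.
case: fU aU => ->; case: asboolP => // Ua [h1 h2].
  by move: (h2 Ua); rewrite ler10.
by case: Ua; apply: h1; rewrite lexx.
Qed.

Lemma question_comp_one_minus a : sharp a ->
  obs_comp (@measurable_one_minus R) (question R a) = question R (oc a).
Proof.
move=> sa; have qa := Rep_question hE sa.
apply: (Rep_uniq hE (Rep_comp (@measurable_one_minus R) (qa R))).
apply: (Rep_ae (Rep_question hE (sharp_oc sa))).
apply: filterS (ae_ultra E) => U uU /=.
have [Ua|nUa] := pselect (U a).
  by rewrite (asboolT Ua) subrr asboolF// => /(ultra_ocE hE uU sa).
by rewrite (asboolF nUa) subr0 asboolT//; exact: ((ultra_ocE hE uU sa).2 nUa).
Qed.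

Lemma unit_interval_bounded x : olson (question R pzero) x ->
  olson x (question R pone) -> bounded_obs x.
Proof.
(* The spectral resolution of the question of 1 reaches 1 only to the right of
   the point 1; the right end 2 leaves room for that. *)
move=> /(_ 0) x0 /(_ 2) x1; exists 0, 2.
have {}x0 : spec x 0 = pzero 
  by apply: ple0_eq; move: x0; rewrite spec_question ltxx ltr10.
have {}x1 : spec x 2 = pone.
  apply: ple_anti; first exact: ple1.
  by move: x1; rewrite spec_question ltr1n.
have h : psum (spec x 0) (x (borel_itv `[0, 2[)) (spec x 2).
  apply: (obsU (obs_axioms x)) => /=.
    rewrite -subset0 => r /= []; rewrite !in_itv /= => r0 /andP[].
    by rewrite leNgt r0.
  apply/seteqP; split=> r; rewrite /= !in_itv /=.
    by case: (ltP r 0) => [r0 _|r0 r2]; [left|right].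
  by case=> [/lt_trans|/andP[]//]; apply; rewrite ltr0n.
rewrite x0 in h; have x02 := psum_fun h (psum0a _); rewrite x1 in x02.
apply: ple_anti; first exact: ple1.
by rewrite x02; apply: obs_mono => r /=; rewrite !in_itv /= => /andP[-> /ltW].
Qed.

End Questions.

Section UnitInterval.
Variables (R : realType) (E : effectAlgebra).
Hypothesis hE : is_sigma_MV_effect_algebra E.
Implicit Types (f g : stone E -> R) (x y z w : observable R E) (a b c : E).

Lemma unit_interval_fun x : sharp_obs x -> olson (question R pzero) x ->
  olson x (question R pone) ->
  exists f, [/\ measurable_fun setT f, Rep f x & ae (fun U => 0 <= f U <= 1)].
Proof.
move=> sx x0 x1.
have [f mf fx] := fun_of_observable hE sx (unit_interval_bounded x0 x1).
exists f; split=> //.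
have := (olsonP hE (Rep_question0 hE) fx).1 x0.
have := (olsonP hE fx (Rep_question1 hE)).1 x1.
by apply: filterS2 => U /= -> ->.
Qed.

Lemma olson_one_minus x : sharp_obs x -> olson (question R pzero) x ->
  olson x (question R pone) ->
  let x' := obs_comp (@measurable_one_minus R) x in
  olson (question R pzero) x' /\ olson x' (question R pone).
Proof.
move=> sx x0 x1 x'; have [f [mf fx f01]] := unit_interval_fun sx x0 x1.
have fx' := Rep_comp (@measurable_one_minus R) fx.
split.
  apply/(olsonP hE (Rep_question0 hE) fx').
  by apply: filterS f01 => U /andP[_ f1] /=; rewrite subr_ge0.
apply/(olsonP hE fx' (Rep_question1 hE)).
by apply: filterS f01 => U /andP[f0 _] /=; rewrite gerBl.
Qed.

(** For a function [f] with values in [[0, 1]], the maximum of [f] and [1 - f]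
    is [1] exactly where [f] is [0] or [1]. Bounded upper bounds of [x] and
    [obs_comp _ x] need not be sharp; when [x] is a question, they are handled
    through their spectral resolutions. *)
Lemma join_one_minusP x : sharp_obs x -> olson (question R pzero) x ->
  olson x (question R pone) ->
  bounded_join x (obs_comp (@measurable_one_minus R) x) (question R pone) <->
  exists a, sharp a /\ x = question R a.
Proof.
move=> sx x0 x1; have [x'0 x'1] := olson_one_minus sx x0 x1.
split=> [[_ [_ [_ least]]]|[a [sa xa]]].
  have [f [mf fx f01]] := unit_interval_fun sx x0 x1.
  have fx' := Rep_comp (@measurable_one_minus R) fx.
  pose g (U : stone E) := Num.max (f U) (1 - f U).
  have mg : measurable_fun setT g.
    by apply: measurable_maxr => //; apply: measurable_funB.
  have [w gw] := observable_of_fun hE mg.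
  have bw : bounded_obs w.
    apply/(bounded_obsP hE gw); exists 0, 1.
    apply: filterS f01 => U /andP[f0 f1]; rewrite /g le_max f0 /= ge_max f1 /=.
    by rewrite gerBl.
  have xw : olson x w.
    by apply/(olsonP hE fx gw); apply: filterE => U; rewrite /g le_max lexx.
  have x'w : olson (obs_comp (@measurable_one_minus R) x) w.
    apply/(olsonP hE fx' gw); apply: filterE => U.
    by rewrite /g le_max /= lexx orbT.
  have /(olsonP hE (Rep_question1 hE) gw) g1 := least w bw xw x'w.
  exists (x (borel_itv `[1, 1])); split; first exact: sx.
  apply: (Rep_zero_one hE fx); apply: filterS2 f01 g1 => U /andP[f0 f1].
  rewrite /g le_max => /orP[f1'|].
    by right; apply/le_anti; rewrite f1.
  by rewrite lerDl oppr_ge0 => f0'; left; apply/le_anti; rewrite f0'.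
split; first exact: question_bounded.
split=> //; split=> //; rewrite xa question_comp_one_minus// => w _ xw x'w t.
rewrite spec_question; case: ifPn => t1; first exact: ple1.
have below b : ple (spec w t) (spec (question R b) t) -> ple (spec w t) (oc b).
  rewrite spec_question (negbTE t1); case: ifPn => // _ /ple_trans; apply.
  exact: ple0.
have /below wa := xw t; have /below := x'w t; rewrite ocK => wa'.
by rewrite (sharp_eq0 sa wa' wa); exact: ple0.
Qed.

Lemma question_inj a b : question R a = question R b -> a = b.
Proof. by move=> ab; rewrite -(question_at1 R a) ab question_at1. Qed.

End UnitInterval.

(** * The group of sharp bounded observables *)

Section SharpBoundedObservables.
Variables (R : realType) (E : effectAlgebra).
Hypothesis hE : is_sigma_MV_effect_algebra E.
Implicit Types (f g : stone E -> R) (x y z : SBO R E).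

Definition sbo_fun x : stone E -> R :=
  sval (cid2 (fun_of_observable hE (svalP x).2 (svalP x).1)).

Lemma measurable_sbo_fun x : measurable_fun setT (sbo_fun x).
Proof. by rewrite /sbo_fun; case: cid2. Qed.

Lemma sbo_funP x : Rep (sbo_fun x) (sval x).
Proof. by rewrite /sbo_fun; case: cid2. Qed.

Lemma sbo_fun_bounded x : ae_bounded (sbo_fun x).
Proof. by apply/(bounded_obsP hE (sbo_funP x)); exact: (svalP x).1. Qed.

Lemma sbo_inj x y : sval x = sval y -> x = y.
Proof. by case: x y => [x px] [y py] /= xy; exact: eq_exist. Qed.

Lemma sbo_eqP x y : x = y <-> ae (fun U => sbo_fun x U = sbo_fun y U).
Proof.
rewrite -(observable_eqP hE (sbo_funP x) (sbo_funP y)).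
by split=> [->|/sbo_inj].
Qed.

Lemma sbo_of_fun f : measurable_fun setT f -> ae_bounded f ->
  exists x, ae (fun U => sbo_fun x U = f U).
Proof.
move=> mf bf; have [x fx] := observable_of_fun hE mf.
have bx : bounded_obs x by apply/(bounded_obsP hE fx).
exists (exist _ x (conj bx (Rep_sharp fx))).
exact/(observable_eqP hE (sbo_funP _) fx).
Qed.

Lemma gleP x y : gle x y <-> ae (fun U => sbo_fun x U <= sbo_fun y U).
Proof. exact: (olsonP hE (sbo_funP x) (sbo_funP y)). Qed.

Lemma ae_bounded_add f g : ae_bounded f -> ae_bounded g -> ae_bounded (f \+ g).
Proof.
move=> [a [b fab]] [c [d gcd]]; exists (a + c), (b + d).
by apply: filterS2 fab gcd => U /andP[af fb] /andP[cg gd]; rewrite !lerD.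
Qed.

Lemma ae_bounded_opp f : ae_bounded f -> ae_bounded (\- f).
Proof.
move=> [a [b fab]]; exists (- b), (- a).
by apply: filterS fab => U /andP[af fb]; rewrite !lerN2 fb.
Qed.

Lemma ae_bounded_max f g : ae_bounded f -> ae_bounded g ->
  ae_bounded (fun U => Num.max (f U) (g U)).
Proof.
move=> [a [b fab]] [c [d gcd]]; exists a, (Num.max b d).
apply: filterS2 fab gcd => U /andP[af fb] /andP[cg gd].
by rewrite le_max af /= ge_max !le_max fb gd orbT.
Qed.

Lemma ae_bounded_min f g : ae_bounded f -> ae_bounded g ->
  ae_bounded (fun U => Num.min (f U) (g U)).
Proof.
move=> [a [b fab]] [c [d gcd]]; exists (Num.min a c), b.
apply: filterS2 fab gcd => U /andP[af fb] /andP[cg gd].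
by rewrite le_min !ge_min af cg fb orbT.
Qed.

Lemma gsumP x y z :
  gsum x y z <-> ae (fun U => sbo_fun z U = sbo_fun x U + sbo_fun y U).
Proof.
have sumE w : ae (fun U => sbo_fun w U = sbo_fun x U + sbo_fun y U) -> gsum x y w.
  move=> wxy; apply: (Rep_obs_sum hE (sbo_funP x) (sbo_funP y)).
    exact: Rep_ae (sbo_funP w) wxy.
  exact: (svalP w).1.
split=> [xyz|]; last exact: sumE.
have [w wxy] := sbo_of_fun
  (measurable_funD (measurable_sbo_fun x) (measurable_sbo_fun y))
  (ae_bounded_add (sbo_fun_bounded x) (sbo_fun_bounded y)).
by rewrite (_ : z = w)//; apply/sbo_inj/(obs_sum_uniq xyz)/sumE.
Qed.

Lemma sbo_fun_question (a : E) (sa : sharp a) :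
  ae (fun U => sbo_fun (sbo_question R sa : SBO R E) U = (`[< U a >])%:R).
Proof. exact/(observable_eqP hE (sbo_funP _) (Rep_question hE sa)). Qed.

Lemma sbo_fun0 : ae (fun U => sbo_fun gzero U = 0).
Proof. exact/(observable_eqP hE (sbo_funP _) (Rep_question0 hE)). Qed.

Lemma sbo_fun1 : ae (fun U => sbo_fun (sbo_question R (sharp1 E) : SBO R E) U = 1).
Proof. exact/(observable_eqP hE (sbo_funP _) (Rep_question1 hE)). Qed.

Lemma sbo_add x y : exists z, gsum x y z.
Proof.
have [z zxy] := sbo_of_fun
  (measurable_funD (measurable_sbo_fun x) (measurable_sbo_fun y))
  (ae_bounded_add (sbo_fun_bounded x) (sbo_fun_bounded y)).
by exists z; exact/gsumP.
Qed.

Lemma sbo_opp : exists N : SBO R E -> SBO R E,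
  forall x, ae (fun U => sbo_fun (N x) U = - sbo_fun x U).
Proof.
suff /choice [N NE] x : exists y, ae (fun U => sbo_fun y U = - sbo_fun x U).
  by exists N.
apply: sbo_of_fun (ae_bounded_opp (sbo_fun_bounded x)).
by apply: measurableT_comp => //; exact: measurable_sbo_fun.
Qed.

Lemma SBO_abelian_group : is_abelian_group (SBO R E).
Proof.
split.
- move=> x y; have [z xyz] := sbo_add x y; exists z; split=> // w xyw.
  exact/sbo_inj/(obs_sum_uniq xyz).
- by move=> x y z /gsumP xyz; apply/gsumP; apply: filterS xyz => U ->; rewrite addrC.
- move=> x y z s t u /gsumP xys /gsumP szt /gsumP yzu; apply/gsumP.
  by apply: filterS3 xys szt yzu => U xys -> ->; rewrite xys addrA.
- by move=> x; apply/gsumP; apply: filterS sbo_fun0 => U ->; rewrite add0r.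
- move=> x; have [N NE] := sbo_opp; exists (N x); apply/gsumP.
  by apply: filterS2 sbo_fun0 (NE x) => U -> ->; rewrite subrr.
Qed.

(** The pointwise supremum is taken after truncation at a bound [beta] of the
    dominating element, which makes it finite everywhere and changes the
    functions only on a null set. *)
Lemma sbo_sequence_lub (u : nat -> SBO R E) (b : SBO R E) :
  (forall n, gle (u n) b) -> exists s, is_lub (@gle (SBO R E)) (range u) s.
Proof.
move=> ub; have [lb [beta bbeta]] := sbo_fun_bounded b.
have [alpha [ubu alphau]] := sbo_fun_bounded (u 0%N).
pose h n (U : stone E) := Num.min (sbo_fun (u n) U) beta.
pose f (U : stone E) := sups (h^~ U) 0.
have hub U : has_ubound (range (h^~ U)).
  by exists beta => _ [n _ <-]; rewrite /h ge_min lexx orbT.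
have mf : measurable_fun setT f.
  apply: measurable_fun_sups => [U _|n]; first exact: hub.
  by apply: measurable_minr => //; exact: measurable_sbo_fun.
have fE U : f U = sup (range (h^~ U)).
  by rewrite /f /sups /sdrop; congr sup; apply/seteqP; split=> r [n _ <-]; exists n.
have hf n U : h n U <= f U by rewrite fE; apply: ub_le_sup => //; exists n.
have fle U (r : R) : (forall n, h n U <= r) -> f U <= r.
  move=> hr; rewrite fE; apply: ge_sup; first by exists (h 0%N U), 0%N.
  by move=> _ [n _ <-].
have bf : ae_bounded f.
  exists (Num.min alpha beta), beta; apply: filterS alphau => U /andP[alphau _].
  rewrite fle ?andbT => [|n]; last by rewrite /h ge_min lexx orbT.
  by apply: le_trans (hf 0%N U); rewrite /h le_min !ge_min alphau /= lexx orbT.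
have [s sf] := sbo_of_fun mf bf.
exists s; split=> [_ [n _ <-]|c uc].
  apply/gleP; have /gleP unb := ub n.
  apply: filterS3 bbeta unb sf => U /andP[_ bU] ubU ->.
  apply: le_trans (hf n U); rewrite /h le_min lexx /=.
  exact: le_trans ubU bU.
have /ae_nat uc' n : ae (fun U => sbo_fun (u n) U <= sbo_fun c U).
  by apply/gleP/uc; exists n.
apply/gleP; apply: filterS2 uc' sf => U ucU ->; apply: fle => n.
by rewrite /h ge_min ucU.
Qed.

Lemma SBO_dedekind_sigma_complete : is_dedekind_sigma_complete (SBO R E).
Proof.
move=> S cS neS [b Sb]; have [u uS] := countable_enumeration cS neS.
have ub n : gle (u n) b by apply: Sb; rewrite -uS; exists n.
by have [s] := sbo_sequence_lub ub; rewrite uS => lubs; exists s.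
Qed.

Lemma sbo_countable_glb (S : set (SBO R E)) : countable S -> S !=set0 ->
  (exists b, forall x, S x -> gle b x) -> exists m, is_glb (@gle (SBO R E)) S m.
Proof.
move=> cS [x0 Sx0] [b bS]; have [N NE] := sbo_opp.
have Nle x y : gle x y <-> gle (N y) (N x).
  rewrite !gleP; split; apply: filterS3 (NE x) (NE y) => U; last first.
    by move=> -> ->; rewrite lerN2.
  by move=> -> ->; rewrite lerN2.
have NK x : N (N x) = x.
  by apply/sbo_eqP; apply: filterS2 (NE x) (NE (N x)) => U -> ->; rewrite opprK.
have [||s [ubs lubs]] := @SBO_dedekind_sigma_complete (N @` S) (countable_image N cS).
- by exists (N x0), x0.
- by exists (N b) => _ [x Sx <-]; apply/Nle; rewrite !NK; exact: bS.
exists (N s); split=> [x Sx|c cl].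
  by apply/Nle; rewrite NK; apply: ubs; exists x.
apply/Nle; rewrite NK; apply: lubs => _ [x Sx <-].
by apply/Nle; rewrite !NK; exact: cl.
Qed.

Lemma SBO_lgroup : is_lgroup (SBO R E).
Proof.
have cxy x y : countable [set x; y].
  exact/finite_set_countable/finite_set2.
have nxy x y : [set x; y] !=set0 by exists x; left.
split.
- exact: SBO_abelian_group.
- by move=> x; exact: olson_refl.
- move=> x y /gleP xy /gleP yx; apply/sbo_eqP.
  by apply: filterS2 xy yx => U xy yx; apply/le_anti; rewrite xy yx.
- move=> x y z /gleP xy /gleP yz; apply/gleP.
  by apply: filterS2 xy yz => U; exact: le_trans.
- move=> x y z s t /gleP xy /gsumP xzs /gsumP yzt; apply/gleP.
  by apply: filterS3 xy xzs yzt => U xy -> ->; rewrite lerD2r.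
- move=> x y; apply: SBO_dedekind_sigma_complete => //.
  have [b bmax] := sbo_of_fun
    (measurable_maxr (measurable_sbo_fun x) (measurable_sbo_fun y))
    (ae_bounded_max (sbo_fun_bounded x) (sbo_fun_bounded y)).
  by exists b => _ [->|->]; apply/gleP; apply: filterS bmax => U ->;
    rewrite le_max lexx ?orbT.
- move=> x y; apply: sbo_countable_glb => //.
  have [b bmin] := sbo_of_fun
    (measurable_minr (measurable_sbo_fun x) (measurable_sbo_fun y))
    (ae_bounded_min (sbo_fun_bounded x) (sbo_fun_bounded y)).
  by exists b => _ [->|->]; apply/gleP; apply: filterS bmin => U ->;
    rewrite ge_min lexx ?orbT.
Qed.

End SharpBoundedObservables.

(** * The unit interval of the group *)

(** Everything else is determined by the partial sum, so a bijection that
    preserves and reflects it is a sigma-isomorphism. *)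
Lemma sigma_isomorphism_of_psum (P Q : partialAlgebra) (phi : P -> Q) (psi : Q -> P) :
  cancel phi psi -> cancel psi phi -> phi pzero = pzero -> phi pone = pone ->
  (forall a b c, psum a b c <-> psum (phi a) (phi b) (phi c)) ->
  is_sigma_isomorphism phi.
Proof.
move=> phiK psiK phi0 phi1 phiD.
have phile a b : ple a b <-> ple (phi a) (phi b).
  split=> [[c /phiD abc]|[c]]; first by exists (phi c).
  by rewrite -[c]psiK => /phiD abc; exists (psi c).
split; first by exists psi.
split=> //; split=> //; split.
  move=> a b; split=> [[c /phiD abc]|[c]]; first by exists (phi c).
  by rewrite -[c]psiK => /phiD abc; exists (psi c).
split=> [a b c /phiD //|S s _ [ub least]]; split=> [_ [a Sa <-]|b hb].
  by apply/phile/ub.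
rewrite -[b]psiK; apply/phile/least => a Sa.
by apply/phile; rewrite psiK; apply: hb; exists a.
Qed.

Section UnitIntervalAlgebra.
Variables (R : realType) (E : effectAlgebra).
Hypothesis hE : is_sigma_MV_effect_algebra E.

Local Notation M := (Gamma_SBO R E).
Local Notation q1 := (sbo_question R (sharp1 E)).

Definition gamma_fun (a : M) : stone E -> R := sbo_fun hE (sval a).

Implicit Types (f g : stone E -> R) (a b c : M).

Lemma gamma_inj a b : sval a = sval b -> a = b.
Proof. by case: a b => [a pa] [b pb] /= ab; exact: eq_exist. Qed.

Lemma gamma_eqP a b : a = b <-> ae (fun U => gamma_fun a U = gamma_fun b U).
Proof. by rewrite -sbo_eqP; split=> [->|/gamma_inj]. Qed.

Lemma gamma_fun01 a : ae (fun U => 0 <= gamma_fun a U <= 1).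
Proof.
have [/(gleP hE) a0 /(gleP hE) a1] := svalP a.
have := [elaborate filterI a0 a1].
apply: filterS3 (sbo_fun0 R hE) (sbo_fun1 R hE) => U f0 f1 [].
by rewrite f0 f1 /gamma_fun => -> ->.
Qed.

Lemma gamma_of_fun f : measurable_fun setT f -> ae (fun U => 0 <= f U <= 1) ->
  exists a, ae (fun U => gamma_fun a U = f U).
Proof.
move=> mf f01.
have [x xf] : exists x : SBO R E, ae (fun U => sbo_fun hE x U = f U).
  by apply: sbo_of_fun mf _; exists 0, 1.
have x01 : gle (gzero : SBO R E) x /\ gle x (q1 : SBO R E).
  split; apply/(gleP hE).
    by apply: filterS3 (sbo_fun0 R hE) f01 xf => U -> /andP[f0 _] ->.
  by apply: filterS3 (sbo_fun1 R hE) f01 xf => U -> /andP[_ f1] ->.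
by exists (exist _ x x01).
Qed.

Lemma gamma_psumP a b c :
  psum a b c <-> ae (fun U => gamma_fun c U = gamma_fun a U + gamma_fun b U).
Proof. exact: gsumP. Qed.

Lemma gamma_fun_zero : ae (fun U => gamma_fun pzero U = 0).
Proof. exact: sbo_fun0. Qed.

Lemma gamma_fun_one : ae (fun U => gamma_fun pone U = 1).
Proof. exact: sbo_fun1. Qed.

Lemma measurable_gamma_fun a : measurable_fun setT (gamma_fun a).
Proof. exact: measurable_sbo_fun. Qed.

Lemma gamma_pleP a b : ple a b <-> ae (fun U => gamma_fun a U <= gamma_fun b U).
Proof.
split=> [[c /gamma_psumP abc]|ab].
  by apply: filterS2 abc (gamma_fun01 c) => U -> /andP[c0 _]; rewrite lerDl.
have [c cE] : exists c, ae (fun U => gamma_fun c U = gamma_fun b U - gamma_fun a U).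
  apply: gamma_of_fun.
    by apply: measurable_funB; exact: measurable_gamma_fun.
  apply: filterS3 ab (gamma_fun01 a) (gamma_fun01 b) => U ab /andP[a0 _] /andP[_ b1].
  by rewrite subr_ge0 ab /= (le_trans _ b1)// gerBl.
by exists c; apply/gamma_psumP; apply: filterS cE => U ->; rewrite addrC subrK.
Qed.

Lemma gamma_ple_gle a b : ple a b <-> gle (sval a) (sval b).
Proof. by rewrite gamma_pleP (gleP hE). Qed.

Lemma gamma_psum_ex a b : ae (fun U => gamma_fun a U + gamma_fun b U <= 1) ->
  Defs.summable a b.
Proof.
move=> ab1.
have [c cE] : exists c, ae (fun U => gamma_fun c U = gamma_fun a U + gamma_fun b U).
  apply: gamma_of_fun.
    by apply: measurable_funD; exact: measurable_gamma_fun.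
  apply: filterS3 ab1 (gamma_fun01 a) (gamma_fun01 b) => U -> /andP[a0 _] /andP[b0 _].
  by rewrite addr_ge0.
by exists c; apply/gamma_psumP.
Qed.

Lemma gamma_complement a : exists b, ae (fun U => gamma_fun b U = 1 - gamma_fun a U).
Proof.
apply: gamma_of_fun.
  by apply: measurable_funB => //; exact: measurable_gamma_fun.
by apply: filterS (gamma_fun01 a) => U /andP[a0 a1]; rewrite subr_ge0 a1 gerBl.
Qed.

Lemma Gamma_psumC a b c : psum a b c -> psum b a c.
Proof.
move=> /gamma_psumP abc; apply/gamma_psumP.
by apply: filterS abc => U ->; rewrite addrC.
Qed.

Lemma Gamma_psumA a b c d s : psum a b s -> psum s c d ->
  exists t, psum b c t /\ psum a t d.
Proof.
move=> /gamma_psumP abs /gamma_psumP scd.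
have [t bct] : Defs.summable b c.
  apply: gamma_psum_ex.
  apply: filterS3 (filterI abs scd) (gamma_fun01 a) (gamma_fun01 d).
  move=> U [-> ->] /andP[a0 _] /andP[_]; apply: le_trans.
  by rewrite -addrA lerDr.
exists t; split=> //; apply/gamma_psumP; move/gamma_psumP: bct => bct.
by apply: filterS3 abs scd bct => U abs -> ->; rewrite abs addrA.
Qed.

Lemma Gamma_effect_algebra : is_effect_algebra M.
Proof.
split.
- move=> a b c d /gamma_psumP abc /gamma_psumP abd; apply/gamma_eqP.
  by apply: filterS2 abc abd => U -> ->.
- exact: Gamma_psumC.
- move=> a b c d; split=> [[s [abs scd]]|[t [/Gamma_psumC cbt /Gamma_psumC tad]]].
    exact: Gamma_psumA abs scd.
  have [s [/Gamma_psumC abs /Gamma_psumC scd]] := Gamma_psumA cbt tad.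
  by exists s.
- move=> a; have [b bE] := gamma_complement a; exists b; split.
    apply/gamma_psumP; apply: filterS2 gamma_fun_one bE => U -> ->.
    by rewrite addrC subrK.
  move=> c /gamma_psumP ac1; apply/gamma_eqP.
  apply: filterS3 gamma_fun_one bE ac1 => U one -> ac1U.
  by rewrite -one ac1U addrC addKr.
- move=> a [c /gamma_psumP a1c]; apply/gamma_eqP.
  have a01 := gamma_fun01 a; have c01 := gamma_fun01 c.
  apply: filterS3 (filterI gamma_fun_zero gamma_fun_one) a1c (filterI a01 c01).
  move=> U [-> one] cE [/andP[a0 _] /andP[_]]; rewrite cE one gerDr => a0'.
  by apply/le_anti; rewrite a0 a0'.
Qed.

Local Notation MA := (EffectAlgebra Gamma_effect_algebra).

Lemma Gamma_countable_lub (S : set M) : countable S -> exists s, is_lub (@ple M) S s.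
Proof.
move=> cS; have [->|/set0P [a0 Sa0]] := eqVneq S set0.
  by exists pzero; split=> // b _; exact: (@ple0 MA).
have lsup : exists s, is_lub (@gle (SBO R E)) (@sval _ _ @` S) s.
  apply: (SBO_dedekind_sigma_complete hE); first exact: countable_image.
    by exists (sval a0), a0.
  by exists q1 => _ [a _ <-]; exact: (svalP a).2.
have [s [ubs lubs]] := lsup.
have s01 : gle (gzero : SBO R E) s /\ gle s (q1 : SBO R E).
  split; last by apply: lubs => _ [a _ <-]; exact: (svalP a).2.
  apply: (gle_trans (SBO_lgroup R hE) (svalP a0).1).
  by apply: ubs; exists a0.
exists (exist _ s s01); split=> [a Sa|b hb]; apply/gamma_ple_gle.
  by apply: ubs; exists a.
by apply: lubs => _ [a Sa <-]; apply/gamma_ple_gle/hb.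
Qed.

(** The orthosupplement is an antitone involution. *)
Lemma Gamma_countable_glb (S : set M) : countable S -> exists m, is_glb (@ple M) S m.
Proof.
move=> cS.
have [s lubs] := Gamma_countable_lub (countable_image (@oc MA) cS).
exists (@oc MA s).
have := @is_lub_oc MA _ _ lubs.
rewrite image_comp (_ : (@oc MA \o @oc MA) = id) ?image_id//.
by apply/funext => a; exact: (@ocK MA).
Qed.

Lemma Gamma_sigma_MV : is_sigma_MV_effect_algebra MA.
Proof.
have complete (S : set M) : countable S ->
    (exists s, is_lub (@ple M) S s) /\ (exists m, is_glb (@ple M) S m).
  by move=> cS; split; [exact: Gamma_countable_lub|exact: Gamma_countable_glb].
split=> //; split=> [a b|a b /is_glb2P ab0].
  exact/complete/finite_set_countable/finite_set2.
have [m mE] : exists m, ae (fun U =>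
    gamma_fun m U = Num.min (gamma_fun a U) (gamma_fun b U)).
  apply: gamma_of_fun.
    by apply: measurable_minr; exact: measurable_gamma_fun.
  apply: filterS2 (gamma_fun01 a) (gamma_fun01 b) => U /andP[a0 a1] /andP[b0 b1].
  by rewrite le_min a0 b0 ge_min a1.
have m0 : m = pzero.
  apply: ab0; apply/gamma_pleP; apply: filterS mE => U ->.
    by rewrite ge_min lexx.
  by rewrite ge_min lexx orbT.
rewrite m0 in mE; apply: gamma_psum_ex.
apply: filterS3 (filterI gamma_fun_zero mE) (gamma_fun01 a) (gamma_fun01 b).
move=> U [-> min0] /andP[a0 a1] /andP[b0 b1].
move: min0; rewrite /Order.min; case: ifP => _ <-; first by rewrite add0r.
by rewrite addr0.
Qed.

Lemma gamma_oc a : ae (fun U => gamma_fun (@oc MA a) U = 1 - gamma_fun a U).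
Proof.
have /gamma_psumP := @psum_oc MA a.
by apply: filterS2 gamma_fun_one => U -> ->; rewrite addrC addKr.
Qed.

Lemma gamma_sharpP a : @sharp MA a <->
  ae (fun U => gamma_fun a U = 0 \/ gamma_fun a U = 1).
Proof.
rewrite /sharp is_glb2P; split=> [sa|a01 z].
  have [m mE] : exists m, ae (fun U =>
      gamma_fun m U = Num.min (gamma_fun a U) (1 - gamma_fun a U)).
    apply: gamma_of_fun.
      apply: measurable_minr; first exact: measurable_gamma_fun.
      by apply: measurable_funB => //; exact: measurable_gamma_fun.
    apply: filterS (gamma_fun01 a) => U /andP[a0 a1].
    by rewrite le_min a0 subr_ge0 ge_min a1.
  have m0 : m = pzero.
    apply: sa; apply/gamma_pleP; apply: filterS2 mE (gamma_oc a) => U ->.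
      by rewrite ge_min lexx.
    by move=> ->; rewrite ge_min lexx orbT.
  rewrite m0 in mE; apply: filterS2 gamma_fun_zero mE => U ->.
  rewrite /Order.min; case: ifP => _ min0; first by left.
  by right; apply/esym/eqP; rewrite -subr_eq0 -min0.
move=> /gamma_pleP za /gamma_pleP za'; apply/gamma_eqP.
apply: filterS3 (filterI gamma_fun_zero a01) (filterI (gamma_fun01 z) (gamma_oc a))
  (filterI za za').
move=> U [-> a01U] [/andP[z0 _] ocE] [za1]; rewrite ocE => za2.
apply/le_anti; rewrite z0 andbT.
by case: a01U za1 za2 => -> //; rewrite subrr.
Qed.

Lemma question_unit_interval (e : E) (se : sharp e) :
  gle (gzero : SBO R E) (sbo_question R se) /\ gle (sbo_question R se : SBO R E) q1.
Proof.
split; apply/(gleP hE).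
  by apply: filterS2 (sbo_fun0 R hE) (sbo_fun_question R hE se) => U -> ->.
apply: filterS2 (sbo_fun1 R hE) (sbo_fun_question R hE se) => U -> ->.
by case: asboolP.
Qed.

Definition gamma_question (e : E) (se : sharp e) : M :=
  exist _ (sbo_question R se : SBO R E) (question_unit_interval se).

Lemma gamma_question_fun (e : E) (se : sharp e) :
  ae (fun U => gamma_fun (gamma_question se) U = (`[< U e >])%:R).
Proof. exact: sbo_fun_question. Qed.

Lemma gamma_question_sharp (e : E) (se : sharp e) : @sharp MA (gamma_question se).
Proof.
apply/gamma_sharpP; apply: filterS (gamma_question_fun se) => U ->.
by case: asboolP; [right|left].
Qed.

Definition question_of_sharp (e : Sh E) : Sh MA :=
  exist _ (gamma_question (svalP e)) (gamma_question_sharp (svalP e)).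

Definition sharp_of_question (a : Sh MA) : Sh E :=
  exist _ _ ((svalP (sval (sval a))).2 (borel_itv `[1, 1])).

Lemma Sh_inj (F : effectAlgebra) (u v : Sh F) : sval u = sval v -> u = v.
Proof. by case: u v => [u su] [v sv] /= uv; exact: eq_exist. Qed.

Lemma question_of_sharpK : cancel question_of_sharp sharp_of_question.
Proof. by move=> e; apply: Sh_inj; exact: question_at1. Qed.

Lemma sharp_of_questionK : cancel sharp_of_question question_of_sharp.
Proof.
move=> a; apply: Sh_inj; apply: gamma_inj; apply: sbo_inj; apply/esym.
apply: (Rep_zero_one hE (sbo_funP hE _)).
exact: (gamma_sharpP _).1 (svalP a).
Qed.

Lemma psum_question (e e' d : Sh E) : psum e e' d <->
  psum (question_of_sharp e) (question_of_sharp e') (question_of_sharp d).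
Proof.
split=> [eed|qqq].
  exact: (question_sum R hE (svalP e) (svalP e') eed).
have [se se'] := (svalP e, svalP e').
have [d' eed'] : Defs.summable (sval e) (sval e').
  apply/summable_ple; apply: (ae_ple hE); [exact: se|exact: sharp_oc se'|].
  have /gamma_psumP sumE := qqq : psum (gamma_question se) (gamma_question se')
                                       (gamma_question (svalP d)).
  have ab := [elaborate filterI (gamma_question_fun se) (gamma_question_fun se')].
  have dU := [elaborate filterI sumE (gamma_question_fun (svalP d))].
  apply: filterS3 (ae_ultra E) ab dU => U uU [eE e'E] [sumU dE] Ue.
  (* If both indicators were 1 at U, the indicator of d would be 2. *)
  apply/(ultra_ocE hE uU se') => Ue'.
  move: sumU; rewrite eE e'E dE (asboolT Ue) (asboolT Ue') => /eqP.
  by case: asboolP => _ /=; rewrite -natrD eqr_nat.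
have sd' := sharp_psum hE se se' eed'.
suff -> : d = exist _ d' sd' by [].
apply: (can_inj question_of_sharpK); apply: Sh_inj.
apply: (@psum_fun MA _ _ _ _ qqq).
exact: (question_sum R hE se se' eed').
Qed.

Lemma Sh_Gamma_isomorphic : sigma_isomorphic (Sh MA) (Sh E).
Proof.
exists sharp_of_question.
apply: (sigma_isomorphism_of_psum sharp_of_questionK question_of_sharpK).
- by apply: Sh_inj; exact: question_at1.
- by apply: Sh_inj; exact: question_at1.
- move=> a b c; rewrite psum_question.
  by rewrite !sharp_of_questionK.
Qed.

End UnitIntervalAlgebra.

Theorem theorem4p7 (R : realType) (E : effectAlgebra)
    (hE : is_sigma_MV_effect_algebra E) :
  (forall a b c : E, sharp a -> sharp b -> psum a b c ->
     obs_sum (question R a) (question R b) (question R c)) /\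
  (forall x : observable R E, sharp_obs x ->
     olson (question R pzero) x -> olson x (question R pone) ->
     let x' := obs_comp (@measurable_one_minus R) x in
     (olson (question R pzero) x' /\ olson x' (question R pone)) /\
     (bounded_join x x' (question R pone) <->
        exists a : E, sharp a /\ x = question R a) /\
     ((exists a : E, sharp a /\ x = question R a) ->
        exists! a : E, sharp a /\ x = question R a)) /\
  (exists hM : is_effect_algebra (Gamma_SBO R E),
     let M := EffectAlgebra hM in
     is_sigma_MV_effect_algebra M /\ sigma_isomorphic (Sh M) (Sh E)) /\
  (is_lgroup (SBO R E) /\ is_dedekind_sigma_complete (SBO R E)).
Proof.
split; first by move=> a b c; exact: question_sum.
split.
  move=> x sx x0 x1 x'; split; first exact: olson_one_minus.
  split; first exact: join_one_minusP.
  move=> [a [sa xa]]; exists a; split=> // b [_ xb].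
  by apply: (question_inj (R := R)); rewrite -xa.
split; last by split; [exact: SBO_lgroup|exact: SBO_dedekind_sigma_complete].
exists (Gamma_effect_algebra R hE); split.
  exact: Gamma_sigma_MV.
exact: Sh_Gamma_isomorphic.
Qed.
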